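(* Let $u:\mathbb{R}^n\to\mathbb{R}$ be a smooth function and let $M^n\subset\mathbb{R}^{n+1}$ be its graph. Suppose that there is $V\in\mathbb{R}^n$ such that $|\mathrm{grad}\,u-V|\in\mathcal{L}^1(\mathbb{R}^n)$, and that there is $c>0$ such that $\|\mathrm{Hess}\,u\|^2\le c\,(1+|\mathrm{grad}\,u|^2)$ on $\mathbb{R}^n$. If the mean curvature and the scalar curvature of $M$ do not change sign on $M$, then $M$ is a hyperplane of $\mathbb{R}^{n+1}$ orthogonal to the vector $(-V,1)$.
   Context: The graph of $u$ is $M=\{(x,u(x)):x\in\mathbb{R}^n\}\subset\mathbb{R}^{n+1}$, with the induced metric. $\mathrm{grad}\,u$ and $\mathrm{Hess}\,u$ denote the Euclidean gradient and Hessian of $u$ on $\mathbb{R}^n$, and $\mathcal{L}^1(\mathbb{R}^n)$ is the space of Lebesgue integrable functions on $\mathbb R^n$. $M$ is oriented by the unit normal field $N=\frac1W(-\mathrm{grad}\,u,1)$, $W=\sqrt{1+|\mathrm{grad}\,u|^2}$; its shape operator is $A(Y)=-\overline D_YN$ for $Y$ tangent to $M$, where $\overline D$ is the Levi-Civita connection of $\mathbb{R}^{n+1}$. Let $S_1,S_2$ be the first and second elementary symmetric functions of the eigenvalues of $A$. The mean curvature $H$ and the (normalized) scalar curvature $R$ of $M$ satisfy $S_1=nH$ and $n(n-1)R=2S_2$ (with $n\ge2$, so that the scalar curvature is meaningful). A function does not change sign on $M$ if it is everywhere $\ge0$ or everywhere $\le0$ on $M$ (it may vanish and need not be constant). *)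

(* Defs.v *)
From HB Require Import structures.
From mathcomp Require Import all_boot all_order all_algebra.
From mathcomp Require Import all_classical all_reals all_analysis.

Set Implicit Arguments.
Unset Strict Implicit.
Unset Printing Implicit Defensive.
Import Order.TTheory GRing.Theory Num.Theory.
Import numFieldNormedType.Exports.

Local Open Scope classical_set_scope.
Local Open Scope ring_scope.

(* R^n is 'rV[R]_n. Its library norm is the sup norm, hence a separate
   Euclidean norm; both give the same topology and the same derivatives. *)
Definition dot (R : realType) (n : nat) (v w : 'rV[R]_n) : R :=
  \sum_i v 0 i * w 0 i.

Definition enorm (R : realType) (n : nat) (v : 'rV[R]_n) : R :=
  Num.sqrt (dot v v).

Definition partial (R : realType) (n : nat) (i : 'I_n) (f : 'rV[R]_n -> R) :
    'rV[R]_n -> R :=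
  fun x => 'D_'e_i f x.

Fixpoint class_C (R : realType) (n k : nat) (f : 'rV[R]_n -> R) : Prop :=
  continuous f /\
  if k is k'.+1 then
    forall i : 'I_n, (forall x, derivable f x 'e_i) /\ class_C k' (partial i f)
  else True.

Definition smooth (R : realType) (n : nat) (f : 'rV[R]_n -> R) : Prop :=
  forall k, class_C k f.

Definition grad (R : realType) (n : nat) (u : 'rV[R]_n -> R) (x : 'rV[R]_n) :
    'rV[R]_n :=
  \row_i partial i u x.

Definition Hess (R : realType) (n : nat) (u : 'rV[R]_n -> R) (x : 'rV[R]_n) :
    'M[R]_n :=
  \matrix_(i, j) partial i (partial j u) x.

Definition hsnorm (R : realType) (n : nat) (B : 'M[R]_n) : R :=
  Num.sqrt (\sum_i \sum_j B i j ^+ 2).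

Definition cons_pair (T : Type) (n : nat) (p : T * n.-tuple T) :
    n.+1.-tuple T :=
  [tuple of p.1 :: p.2].

(* The product of the Lebesgue measure of R and of a measure on R^n, carried
   over to R^(n+1). *)
Definition lebesgue_cons (R : realType) (n : nat)
    (mu : {sigma_finite_measure set (n.-tuple (measurableTypeR R)) -> \bar R}) :
    set (n.+1.-tuple (measurableTypeR R)) -> \bar R :=
  pushforward (@lebesgue_measure R \x mu)%E
    (@cons_pair (measurableTypeR R) n).

Section lebesgue_cons_measure.
Variables (R : realType) (n : nat).
Let T := measurableTypeR R.
Variable mu : {sigma_finite_measure set (n.-tuple T) -> \bar R}.

Let measurable_cons_pair : measurable_fun setT (@cons_pair T n).
Proof. exact: (@measurable_cons _ _ (T * n.-tuple T)%type T fst n snd). Qed.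

Let uncons (t : n.+1.-tuple T) : T * n.-tuple T :=
  (thead t, [tuple of behead t]).

Let measurable_uncons : measurable_fun setT uncons.
Proof.
apply/measurable_fun_pairP; split; last exact: measurable_behead.
exact: (measurable_tnth ord0).
Qed.

Let cons_pairK : cancel (@cons_pair T n) uncons.
Proof. by move=> [a t]; congr pair; exact: val_inj. Qed.

Let m : {measure set (T * n.-tuple T)%type -> \bar R} :=
  (@lebesgue_measure R \x mu)%E.

Let lebesgue_cons0 : lebesgue_cons mu set0 = 0%E.
Proof. by rewrite /lebesgue_cons /pushforward preimage_set0 (measure0 m). Qed.

Let lebesgue_cons_ge0 A : (0 <= lebesgue_cons mu A)%E.
Proof. exact: (measure_ge0 m). Qed.

Let lebesgue_cons_sigma_additive : semi_sigma_additive (lebesgue_cons mu).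
Proof.
pose pm : {measure set (n.+1.-tuple T) -> \bar R} :=
  measure_function_pushforward__canonical__measure_function_Measure
    m measurable_cons_pair.
exact: (@measure_semi_sigma_additive _ _ _ pm).
Qed.

HB.instance Definition _ := isMeasure.Build _ _ _ (lebesgue_cons mu)
  lebesgue_cons0 lebesgue_cons_ge0 lebesgue_cons_sigma_additive.

Let lebesgue_cons_sigma_finite : sigma_finite setT (lebesgue_cons mu).
Proof.
have /sigma_finiteP[F [FT ndF Foo]] := sigma_finiteT (@lebesgue_measure R).
have /sigma_finiteP[G [GT ndG Goo]] := sigma_finiteT mu.
exists (fun k => uncons @^-1` (F k `*` G k)).
  rewrite -preimage_bigcup -[LHS](preimage_setT uncons); congr (_ @^-1` _).
  rewrite -setXTT FT GT predeqE => -[x y]; split.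
    move=> [/= [k _ Fkx] [l _ Gly]]; exists (maxn k l) => //; split.
    - by move: x Fkx; exact/subsetPset/ndF/leq_maxl.
    - by move: y Gly; exact/subsetPset/ndG/leq_maxr.
  by move=> [k _ []/= ? ?]; split; exists k.
move=> k; have [mF Fk] := Foo k; have [mG Gk] := Goo k; split.
  by rewrite -[X in measurable X]setTI; apply: measurable_uncons => //;
    exact: measurableX.
rewrite /lebesgue_cons /pushforward -comp_preimage.
rewrite (_ : uncons \o _ = id); last first.
  by apply/funext => p /=; rewrite cons_pairK.
by rewrite preimage_id product_measure1E// lte_mul_pinfty// ge0_fin_numE.
Qed.

HB.instance Definition _ := Measure_isSigmaFinite.Build _ _ _
  (lebesgue_cons mu) lebesgue_cons_sigma_finite.

End lebesgue_cons_measure.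

(* Lebesgue measure on (the Borel subsets of) R^n, as the n-fold product of the
   Lebesgue measure of R. Its carrier is the type of n-tuples of reals, the
   n-dimensional measurable space of the library. *)
Fixpoint lebesgue_tuple (R : realType) (n : nat) :
    {sigma_finite_measure set (n.-tuple (measurableTypeR R)) -> \bar R} :=
  match n with
  | 0 => dirac ([tuple] : 0.-tuple (measurableTypeR R))
  | n'.+1 => lebesgue_cons (lebesgue_tuple R n')
  end.

Definition L1 (R : realType) (n : nat) (f : 'rV[R]_n -> R) : Prop :=
  (lebesgue_tuple R n).-integrable setT
    (fun t => (f (\row_i tnth t i))%:E).

Definition graph_map (R : realType) (n : nat) (u : 'rV[R]_n -> R)
    (x : 'rV[R]_n) : 'rV[R]_(n + 1) :=
  row_mx x (u x)%:M.

Definition graph_of (R : realType) (n : nat) (u : 'rV[R]_n -> R) :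
    set 'rV[R]_(n + 1) :=
  range (graph_map u).

Definition unit_normal (R : realType) (n : nat) (u : 'rV[R]_n -> R)
    (x : 'rV[R]_n) : 'rV[R]_(n + 1) :=
  (Num.sqrt (1 + enorm (grad u x) ^+ 2))^-1 *: row_mx (- grad u x) 1%:M.

(* A(Y) = - D_Y N at the point (x, u x). The covariant derivative of R^(n+1) is
   the directional derivative. For Y tangent to the graph it does not depend on
   how N is extended off the graph; here N is extended as a function that does
   not depend on the last coordinate. *)
Definition shape_operator (R : realType) (n : nat) (u : 'rV[R]_n -> R)
    (x : 'rV[R]_n) (Y : 'rV[R]_(n + 1)) : 'rV[R]_(n + 1) :=
  - 'D_Y (fun p : 'rV[R]_(n + 1) => unit_normal u (lsubmx p)) (graph_map u x).

(* The rows X_1, ..., X_n form a basis of the tangent space at (x, u x). *)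
Definition tangent_frame (R : realType) (n : nat) (u : 'rV[R]_n -> R)
    (x : 'rV[R]_n) : 'M[R]_(n, n + 1) :=
  'J (graph_map u) x.

(* The matrix B of A in this basis: A(X_i) = \sum_j B i j *: X_j. *)
Definition shape_matrix (R : realType) (n : nat) (u : 'rV[R]_n -> R)
    (x : 'rV[R]_n) : 'M[R]_n :=
  (\matrix_i shape_operator u x (row i (tangent_frame u x)))
    *m pinvmx (tangent_frame u x).

(* The eigenvalues of B repeated according to their multiplicity, provided that
   they are all real (which is the case for a shape operator). *)
Definition spectrum (R : realType) (n : nat) (B : 'M[R]_n) : seq R :=
  xget [::] [set s | char_poly B = \prod_(k <- s) ('X - k%:P)].

Definition principal_curvatures (R : realType) (n : nat)
    (u : 'rV[R]_n -> R) (x : 'rV[R]_n) : seq R :=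
  spectrum (shape_matrix u x).

Definition elem_sym (R : realType) (k : nat) (s : seq R) : R :=
  \sum_(I : {set 'I_(size s)} | #|I| == k) \prod_(i in I) s`_i.

(* The curvatures at the point (x, u x), from S_1 = n H and
   n (n - 1) R = 2 S_2; they are meaningful for 2 <= n. *)
Definition mean_curvature (R : realType) (n : nat) (u : 'rV[R]_n -> R)
    (x : 'rV[R]_n) : R :=
  elem_sym 1 (principal_curvatures u x) / n%:R.

Definition scalar_curvature (R : realType) (n : nat) (u : 'rV[R]_n -> R)
    (x : 'rV[R]_n) : R :=
  2 * elem_sym 2 (principal_curvatures u x) / (n * n.-1)%N%:R.

Definition does_not_change_sign (R : realType) (T : Type) (f : T -> R) : Prop :=
  (forall x, 0 <= f x) \/ (forall x, f x <= 0).

(* A hyperplane orthogonal to w when w != 0. *)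
Definition hyperplane (R : realType) (n : nat) (w : 'rV[R]_n) (b : R) :
    set 'rV[R]_n :=
  [set p | dot p w = b].

(* Main.v *)
Require Import Defs.
From HB Require Import structures.
From mathcomp Require Import all_boot all_order all_algebra.
From mathcomp Require Import all_classical all_reals all_analysis.
From mathcomp Require Import measurable_realfun complex.
From mathcomp Require Import ring lra.

Set Implicit Arguments.
Unset Strict Implicit.
Unset Printing Implicit Defensive.
Import Order.TTheory GRing.Theory Num.Theory.
Import numFieldNormedType.Exports.

Local Open Scope classical_set_scope.
Local Open Scope ring_scope.

(** Write W for sqrt (1 + |grad u|^2) and F for grad u / W, the opposite of the
    horizontal part of the unit normal N. In the tangent basis (e_i, d_i u) the
    matrix of the shape operator is the Jacobian matrix DF ([shape_matrixE]), and
    DF is W^-1 Hess u (1 - W^-2 p^T p), where p is the row grad u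
    ([gauss_jacobianE]). The second factor is the square of a symmetric
    invertible matrix, so DF is similar to a symmetric matrix: its eigenvalues
    are real and S_1 = tr DF, 2 S_2 = (tr DF)^2 - tr (DF DF)
    ([graph_shape_elem_sym]).

    Both curvatures are divergences on R^n. Let F_0 = V / sqrt (1 + |V|^2), the
    value of F on an affine graph of slope V, and Z = F - F_0. Then
      S_1 = div Z   and   2 S_2 = div Y,  Y_i = sum_j (d_j F_j Z_i - d_j F_i Z_j),
    the terms with second derivatives of F cancelling by symmetry. The map
    p |-> p / sqrt (1 + |p|^2) is Lipschitz ([normalized_lipschitz]), so Z is
    integrable because |grad u - V| is; the bound on Hess u makes DF bounded
    ([partial_gauss_bounded]), so Y is integrable too.

    An integrable vector field on R^n whose divergence has a constant sign is
    divergence free ([divergence_L1]). So S_1 = S_2 = 0, whence tr (DF DF) = 0.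
    For a symmetric matrix the trace of the square is the sum of the squares of
    the entries; by similarity DF = 0 and then Hess u = 0
    ([graph_shape_sqr_tr0]). Therefore grad u is constant; as |grad u - V| is
    integrable over a space of infinite measure, grad u = V and u is affine. *)

(** * Spectra of matrices similar to a symmetric matrix *)

Lemma char_poly_conj (F : fieldType) n (P A : 'M[F]_n) : P \in unitmx ->
  char_poly (invmx P *m A *m P) = char_poly A.
Proof.
move=> Pu; rewrite /char_poly.
have Pu' : map_mx polyC P \in unitmx by rewrite map_unitmx.
have -> : char_poly_mx (invmx P *m A *m P) =
   invmx (map_mx polyC P) *m char_poly_mx A *m map_mx polyC P.
  rewrite /char_poly_mx mulmxBr mulmxBl !map_mxM map_invmx.
  by rewrite mul_mx_scalar -scalemxAl mulVmx // scalemx1.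
by rewrite !det_mulmx mulrC mulrA -det_mulmx mulmxV // det1 mul1r.
Qed.

(** Over the complex numbers a real symmetric matrix is hermitian, hence unitarily
    diagonalizable with real eigenvalues. The trace of the square comes from the
    same diagonalization and gives the second symmetric function of the
    eigenvalues. *)
Lemma symmetric_char_poly (R : rcfType) n (S : 'M[R]_n) : S^T = S ->
  exists d : 'rV[R]_n, char_poly S = \prod_i ('X - (d 0 i)%:P) /\
     \tr (S *m S) = \sum_i d 0 i ^+ 2.
Proof.
move=> Ssym; pose toC := real_complex R; pose A := map_mx toC S.
have Areal : A \is a realmx.
  by apply/mxOverP => i j; rewrite mxE; apply/complex_realP; exists (S i j).
have Aherm : A \is hermsymmx.
  apply: realsym_hermsym => //.
  by apply/is_hermitianmxP; rewrite expr0 scale1r map_mx_id //;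
       apply/matrixP => i j; rewrite !mxE -[in LHS]Ssym mxE.
have /orthomx_spectralP := hermitian_normalmx Aherm.
have /mxOverP := hermitian_spectral_diag_real Aherm.
set D := spectral_diag A; set P := spectralmx A => Dreal AE.
have Pu : P \in unitmx by exact: spectral_unit.
pose d := map_mx (@complex.Re R) D.
have DE : D = map_mx toC d.
  by apply/matrixP => i j; rewrite !mxE; rewrite -[LHS](RRe_real (Dreal _ _)).
exists d; split.
  apply: (map_poly_inj toC); rewrite map_char_poly -/A AE char_poly_conj //.
  rewrite char_poly_trig; last exact/diag_mx_is_trig.
  rewrite map_prod_XsubC; apply: eq_bigr => i _.
  by rewrite DE !mxE eqxx mulr1n.
apply: (@complexI R); rewrite -trace_map_mx map_mxM -/A AE.
rewrite !mulmxA mulmxK // mxtrace_mulC !mulmxA mulmxV // mul1mx.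
rewrite mulmx_diag mxtrace_diag rmorph_sum; apply: eq_bigr => i _.
by rewrite DE !mxE /= rmorphXn expr2.
Qed.

(** The off-diagonal products s_i s_j are grouped according to the pair {i, j},
    which is reached twice. *)
Lemma sqr_sum_elem_sym (R : realType) (s : seq R) :
  (\sum_(i < size s) s`_i) ^+ 2 =
    \sum_(i < size s) s`_i ^+ 2 + 2 * elem_sym 2 s.
Proof.
pose N := size s; rewrite expr2 mulr_suml.
have -> : \sum_(i < N) s`_i * (\sum_(j < N) s`_j) =
          \sum_(i < N) s`_i ^+ 2 + \sum_(i < N) \sum_(j < N | j != i) s`_i * s`_j.
  rewrite -big_split; apply: eq_bigr => i _.
  by rewrite (bigD1 i) //= mulrDr mulr_sumr expr2.
congr (_ + _); rewrite pair_big_dep /= /elem_sym mulr_sumr.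
rewrite (partition_big (fun p : 'I_N * 'I_N => [set p.1; p.2]%SET)
  (fun I => #|I| == 2)) /=; last by move=> [i j] /= ji; rewrite cards2 (eq_sym i) ji.
apply: eq_bigr => I /cards2P[a [b [ab ->]]].
have -> : \prod_(i in [set a; b]%SET) s`_i = s`_a * s`_b.
  by rewrite big_setU1 ?big_set1 // inE.
rewrite (bigD1 (a, b)) /=; last by rewrite eq_sym ab eqxx.
rewrite (bigD1 (b, a)) /=; last first.
  by rewrite ab finset.setUC eqxx /= xpair_eqE negb_and eq_sym ab.
rewrite big1 ?addr0; first by ring.
move=> [i j] /=; rewrite !xpair_eqE => /andP[/andP[/andP[ji /eqP E] nab] nba].
have hi : i \in [set a; b]%SET by rewrite -E set21.
have hj : j \in [set a; b]%SET by rewrite -E set22.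
move: ji nab nba.
by case/finset.set2P: hi => ->; case/finset.set2P: hj => ->; rewrite ?eqxx.
Qed.

Lemma elem_sym1 (R : realType) (s : seq R) :
  elem_sym 1 s = \sum_(i < size s) s`_i.
Proof.
have [s0|s0] := eqVneq (size s) 0%N.
  rewrite (size0nil s0) big_ord0 /elem_sym big_pred0 // => I.
  by apply/negP => /eqP I1; have := max_card (mem I); rewrite I1 card_ord.
have := coefPn_prod_XsubC s0.
rewrite coef_prod_XsubC ?leq_pred // -subn1 subKn ?lt0n // expr1 mulN1r.
by move=> /oppr_inj; rewrite -/(elem_sym 1 s) => ->; rewrite (big_nth 0) big_mkord.
Qed.

(** The elementary symmetric functions of the roots of a split polynomial are,
    up to sign, its coefficients. This is why the choice made in [spectrum] is
    harmless. *)
Lemma elem_sym_roots (R : realType) (k : nat) (s t : seq R) :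
  \prod_(a <- s) ('X - a%:P) = \prod_(a <- t) ('X - a%:P) ->
  elem_sym k s = elem_sym k t.
Proof.
move=> E.
have st : size s = size t.
  by apply: succn_inj; rewrite -(size_prod_XsubC s id) -(size_prod_XsubC t id) E.
have [ks|sk] := leqP k (size s); last first.
  have elem_sym0 r : (size r < k)%N -> elem_sym k r = 0 :> R.
    move=> rk; apply: big_pred0 => I; apply/negP => /eqP Ik.
    by have := max_card (mem I); rewrite Ik card_ord leqNgt rk.
  by rewrite !elem_sym0 // -st.
have coef r : (k <= size r)%N -> elem_sym k r =
    (-1) ^+ k * (\prod_(a <- r) ('X - a%:P))`_(size r - k) :> R.
  move=> kr; rewrite coef_prod_XsubC ?leq_subr // subKn // mulrA -exprD.
  by rewrite addnn -signr_odd odd_double mul1r.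
by rewrite !coef // -?st // E.
Qed.

(** [spectrum B] is a list of eigenvalues only if the characteristic polynomial
    splits over the reals; the symmetric matrix [S] provides a splitting. *)
Lemma elem_sym_spectrum (R : realType) n (B P S : 'M[R]_n) :
  P \in unitmx -> S^T = S -> B = invmx P *m S *m P ->
  elem_sym 1 (spectrum B) = \tr B /\
  2 * elem_sym 2 (spectrum B) = \tr B ^+ 2 - \tr (B *m B).
Proof.
move=> Pu Ssym BE; have [d [dE trE]] := symmetric_char_poly Ssym.
pose s := [seq d 0 i | i : 'I_n].
have sE : char_poly B = \prod_(a <- s) ('X - a%:P).
  by rewrite BE char_poly_conj // dE big_image.
have szs : size s = n by rewrite size_map size_enum_ord.
have sumE (f : R -> R) : \sum_(i < size s) f s`_i = \sum_i f (d 0 i).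
  by rewrite -(big_mkord xpredT (fun i => f s`_i)) -(big_nth 0 xpredT) big_image.
have spE : char_poly B = \prod_(a <- spectrum B) ('X - a%:P).
  by rewrite /spectrum; case: xgetP => [t _ //|/(_ s) []].
have trB : \tr B = \sum_i d 0 i.
  rewrite -(sumE id) /=; have [n0|n0] := posnP n.
    (* char_poly_trace excludes the empty matrix *)
    by rewrite szs; move: {+}B; rewrite n0 => B0; rewrite /mxtrace !big_ord0.
  have := char_poly_trace B n0; have := @coefPn_prod_XsubC _ s.
  rewrite sE szs -lt0n n0 => -> // /oppr_inj <-.
  by rewrite (big_nth 0) big_mkord szs.
have trBB : \tr (B *m B) = \sum_i d 0 i ^+ 2.
  by rewrite -trE BE !mulmxA mulmxK // mxtrace_mulC !mulmxA mulmxV // mul1mx.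
rewrite !(elem_sym_roots _ (etrans (esym spE) sE)) elem_sym1 (sumE id) trB.
split=> //; have := sqr_sum_elem_sym s; rewrite (sumE id) (sumE (fun a => a ^+ 2)).
by rewrite -trBB => ->; rewrite addrAC subrr add0r.
Qed.

Lemma sym_sqr_tr0 (R : realType) n (S : 'M[R]_n) :
  S^T = S -> \tr (S *m S) = 0 -> S = 0.
Proof.
move=> Ssym tr0; have trE : \tr (S *m S) = \sum_i \sum_j S i j ^+ 2.
  apply: eq_bigr => i _; rewrite mxE; apply: eq_bigr => j _.
  by rewrite -[in S j i]Ssym mxE expr2.
apply/matrixP => i j; rewrite mxE; apply/eqP; rewrite -sqrf_eq0; apply/eqP.
have ge0 k l : 0 <= S k l ^+ 2 by exact: sqr_ge0.
have rowge0 k : 0 <= \sum_l S k l ^+ 2 by exact: sumr_ge0.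
move: tr0; rewrite trE => /psumr_eq0P => /(_ (fun k _ => rowge0 k)) /(_ i isT).
by move=> /psumr_eq0P => /(_ (fun k _ => ge0 i k)) /(_ j isT).
Qed.

(** * The matrix of the shape operator of a graph *)

Section graph_matrix.
Variables (R : realType) (n : nat) (p : 'rV[R]_n) (H : 'M[R]_n) (W : R).
Hypotheses (W0 : 0 < W) (WE : W ^+ 2 = 1 + dot p p).

Let pp := p^T *m p.

Let pp_sqr : pp *m pp = dot p p *: pp.
Proof.
rewrite /pp mulmxA -(mulmxA p^T) (_ : p *m p^T = (dot p p)%:M).
  by rewrite mul_mx_scalar -scalemxAl.
by rewrite [LHS]mx11_scalar mxE; congr _%:M; apply: eq_bigr => i _; rewrite mxE.
Qed.

(** The shape operator at a point of a graph with gradient [p] and Hessian [H]: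
    the second fundamental form W^-1 H times the inverse 1 - W^-2 p^T p of the
    first fundamental form 1 + p^T p. *)
Definition graph_shape : 'M[R]_n := W^-1 *: (H *m (1%:M - W ^- 2 *: pp)).

(** The symmetric square root of the inverse metric: (1 + a p^T p)^2 equals
    1 + (2 a + a^2 (W^2 - 1)) p^T p, and this coefficient is - W^-2 for
    a = - 1 / (W (W + 1)). *)
Let K : 'M[R]_n := 1%:M - (W * (W + 1))^-1 *: pp.

(** The inverse of [K]. *)
Let K' : 'M[R]_n := 1%:M + (W + 1)^-1 *: pp.

Let dotE : dot p p = W ^+ 2 - 1. Proof. by rewrite WE addrC addKr. Qed.

Let W_neq0 : W != 0. Proof. exact: lt0r_neq0. Qed.

Let W1_neq0 : W + 1 != 0. Proof. by rewrite lt0r_neq0 // addr_gt0. Qed.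

Let mulpp (a b : R) : (1%:M + a *: pp) *m (1%:M + b *: pp) =
   1%:M + (a + b + a * b * (W ^+ 2 - 1)) *: pp.
Proof.
rewrite mulmxDl !mulmxDr !mul1mx mulmx1 -scalemxAr -scalemxAl pp_sqr dotE.
by rewrite !scalerA -!addrA; congr (_ + _); rewrite -!scalerDl; congr (_ *: _); ring.
Qed.

Let KK : K *m K = 1%:M - W ^- 2 *: pp.
Proof.
rewrite /K -!scaleNr mulpp; congr (_ + _ *: _); field.
by rewrite W_neq0 W1_neq0.
Qed.

Let KK' : K *m K' = 1%:M.
Proof.
rewrite /K /K' -!scaleNr mulpp -[RHS]addr0 -(scale0r pp); congr (_ + _ *: _).
by field; rewrite W_neq0 W1_neq0.
Qed.

Let Kunit : K \in unitmx. Proof. by case: (mulmx1_unit KK'). Qed.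

Let Ktr : K^T = K.
Proof. by rewrite /K linearB linearZ /= trmx1 /pp trmx_mul trmxK. Qed.

(** W^-1 H K K is conjugate, through [K], to the symmetric W^-1 K H K. *)
Let S : 'M[R]_n := W^-1 *: (K *m H *m K).

Let graph_shapeE : graph_shape = invmx K *m S *m K.
Proof.
by rewrite /graph_shape /S -KK -scalemxAr -scalemxAl !mulmxA mulVmx // mul1mx.
Qed.

Hypothesis Hsym : H^T = H.

Let Ssym : S^T = S.
Proof. by rewrite /S linearZ /= !trmx_mul Ktr Hsym mulmxA. Qed.

Lemma graph_shape_elem_sym :
  elem_sym 1 (spectrum graph_shape) = \tr graph_shape /\
  2 * elem_sym 2 (spectrum graph_shape) =
    \tr graph_shape ^+ 2 - \tr (graph_shape *m graph_shape).
Proof. exact: (elem_sym_spectrum Kunit Ssym graph_shapeE). Qed.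

Lemma graph_shape_sqr_tr0 : \tr (graph_shape *m graph_shape) = 0 -> H = 0.
Proof.
rewrite graph_shapeE !mulmxA mulmxK // mxtrace_mulC !mulmxA mulmxV // mul1mx.
move=> /(sym_sqr_tr0 Ssym)/eqP; rewrite scaler_eq0 invr_eq0 (negPf W_neq0) /=.
move=> /eqP KHK0; apply: (can_inj (mulKmx Kunit)); apply: (can_inj (mulmxK Kunit)).
by rewrite KHK0 mulmx0 mul0mx.
Qed.

End graph_matrix.

(** * Directional derivatives along lines *)

Lemma is_derive_line (R : realType) (V W : normedModType R) (g : V -> W) x v s :
  derivable g (x + s *: v) v ->
  is_derive s 1 (fun r : R => g (x + r *: v)) ('D_v g (x + s *: v)).
Proof.
have E : (fun h : R => h^-1 *: (((fun r : R => g (x + r *: v)) \o shift s) (h *: 1)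
    - g (x + s *: v))) =
  (fun h : R => h^-1 *: ((g \o shift (x + s *: v)) (h *: v) - g (x + s *: v))).
  apply/funext => h /=; congr (_ *: (g _ - _)).
  by rewrite [h *: 1]mulr1 scalerDl addrCA.
by move=> dg; apply: DeriveDef; rewrite /derivable /derive E.
Qed.

Lemma is_derive_comp1 (R : realType) (V : normedModType R) (psi : R -> R)
    (f : V -> R) x v a :
  is_derive (f x) 1 psi a -> derivable f x v ->
  is_derive x v (fun y => psi (f y)) (a * 'D_v f x).
Proof.
move=> dpsi df; have x0 : x + 0 *: v = x by rewrite scale0r addr0.
have dl : is_derive (0 : R) 1 (fun h : R => f (x + h *: v)) ('D_v f x).
  by have := @is_derive_line _ _ _ f x v 0; rewrite x0; apply.
have {}dpsi : is_derive (f (x + (0 : R) *: v)) 1 psi a by rewrite x0.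
move: dl; set D := 'D_v f x; move=> dl.
have E : (fun h : R => h^-1 *: (((psi \o (fun h : R => f (x + h *: v))) \o shift 0) (h *: 1)
    - (psi \o (fun h : R => f (x + h *: v))) 0)) =
  (fun h : R => h^-1 *: (((fun y => psi (f y)) \o shift x) (h *: v) - psi (f x))).
  by apply/funext => h /=; rewrite x0 addr0 [h *: 1]mulr1 [x + _]addrC.
have [c l] := is_derive1_comp dpsi dl.
by apply: DeriveDef; rewrite /derivable /derive -E.
Qed.

Lemma is_derive_isqrt (R : realType) (V : normedModType R) (f : V -> R) x v :
  0 < f x -> derivable f x v ->
  is_derive x v (fun y => (Num.sqrt (f y))^-1)
    (- 2^-1 * (Num.sqrt (f x))^-1 ^+ 3 * 'D_v f x).
Proof.
move=> f0; apply: (@is_derive_comp1 _ _ (fun r => (Num.sqrt r)^-1)).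
have s0 : Num.sqrt (f x) != 0 by rewrite gt_eqF // sqrtr_gt0.
have ds := is_derive1_sqrt f0.
apply: is_derive_eq (is_deriveV _ _) _ => //.
by rewrite /GRing.scale /=; field.
Qed.

(** The increment [h] may have either sign; a negative one is treated by running
    along the segment from its other end. *)
Lemma MVT_line (R : realType) (V : normedModType R) (g : V -> R) x v (h : R) :
  (forall y, derivable g y v) ->
  exists2 t : R, 0 <= t <= 1 & g (x + h *: v) - g x = h * 'D_v g (x + (t * h) *: v).
Proof.
move=> dg; wlog h0 : x h / 0 <= h => [pos|].
  have [/pos//|/ltW hle0] := leP 0 h.
  have [|t /andP[t0 t1] E] := pos (x + h *: v) (- h); first by rewrite oppr_ge0.
  exists (1 - t); first by rewrite subr_ge0 t1 gerBl t0.
  apply: oppr_inj; rewrite opprB -mulNr; move: E; rewrite scaleNr addrK => ->.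
  by congr (_ * 'D_v g _); rewrite -addrA -scalerDl; congr (_ + _ *: _); ring.
have [||s] := @MVT_segment _ (fun r => g (x + r *: v))
  (fun r => 'D_v g (x + r *: v)) 0 h h0.
- by move=> s _; exact/is_derive_line/dg.
- apply: derivable_within_continuous => s _.
  exact/(@ex_derive _ _ _ _ _ _ _ (is_derive_line (dg _))).
rewrite in_itv /= => /andP[s0 sh]; rewrite scale0r addr0 subr0 mulrC => E.
have [h_eq0|hn0] := eqVneq h 0.
  by exists 0; [rewrite lexx ler01|rewrite h_eq0 scale0r addr0 subrr mul0r].
exists (s / h); last by rewrite divfK.
by rewrite divr_ge0 // ler_pdivrMr ?mul1r // lt_neqAle eq_sym hn0.
Qed.

(** * Calculus of smooth functions *)

Section partials.
Variables (R : realType) (n : nat).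
Implicit Types (f g : 'rV[R]_n -> R) (i : 'I_n).

Lemma class_C_continuous k f : class_C k f -> continuous f.
Proof. by case: k => [|k] []. Qed.

Lemma class_CW k f : class_C k.+1 f -> class_C k f.
Proof.
elim: k f => [|k IH] f [cf df]; first by split.
by split=> // i; have [? ?] := df i; split => //; exact: IH.
Qed.

Lemma smooth_continuous f : smooth f -> continuous f.
Proof. by move=> /(_ 0) /class_C_continuous. Qed.

Lemma smooth_derivable f i x : smooth f -> derivable f x 'e_i.
Proof. by move=> /(_ 1) [_ /(_ i) []]. Qed.

Lemma smooth_partial f i : smooth f -> smooth (partial i f).
Proof. by move=> sf k; have [_ /(_ i) []] := sf k.+1. Qed.

Lemma partial_cst i (a : R) : partial i (fun=> a) = fun=> 0.
Proof. by apply/funext => x; exact: derive_cst. Qed.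

Lemma partialD i f g : (forall x, derivable f x 'e_i) ->
  (forall x, derivable g x 'e_i) ->
  partial i (fun x => f x + g x) = fun x => partial i f x + partial i g x.
Proof. by move=> df dg; apply/funext => x; exact: deriveD. Qed.

Lemma partialM i f g : (forall x, derivable f x 'e_i) ->
  (forall x, derivable g x 'e_i) ->
  partial i (fun x => f x * g x) =
  fun x => f x * partial i g x + g x * partial i f x.
Proof. by move=> df dg; apply/funext => x; exact: deriveM. Qed.

Lemma class_C_cst k (a : R) : class_C k (fun _ : 'rV[R]_n => a).
Proof.
elim: k a => [|k IH] a; split=> //; try exact: cst_continuous.
by move=> i; split=> [x|]; [exact: derivable_cst|rewrite partial_cst].
Qed.

Lemma class_CD k f g : class_C k f -> class_C k g ->
  class_C k (fun x => f x + g x).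
Proof.
elim: k f g => [|k IH] f g [cf df] [cg dg];
  have cfg : continuous (fun x => f x + g x)
    by move=> x; apply: continuousD; [exact: cf|exact: cg].
  by split.
split=> // i; have [dfi Cf] := df i; have [dgi Cg] := dg i.
split=> [x|]; first exact: derivableD.
by rewrite partialD //; exact: IH.
Qed.

Lemma class_CM k f g : class_C k f -> class_C k g ->
  class_C k (fun x => f x * g x).
Proof.
elim: k f g => [|k IH] f g Cf Cg;
  have cfg : continuous (fun x => f x * g x) by move=> x; apply: continuousM;
    [exact: (class_C_continuous Cf)|exact: (class_C_continuous Cg)].
  by split.
have [cf df] := Cf; have [cg dg] := Cg.
split=> // i; have [dfi Cfi] := df i; have [dgi Cgi] := dg i.
split=> [x|]; first exact: derivableM.
by rewrite partialM //; apply: class_CD; apply: IH => //; exact: class_CW.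
Qed.

Lemma smooth_cst (a : R) : smooth (fun _ : 'rV[R]_n => a).
Proof. by move=> k; exact: class_C_cst. Qed.

Lemma smoothD f g : smooth f -> smooth g -> smooth (fun x => f x + g x).
Proof. by move=> sf sg k; exact: class_CD. Qed.

Lemma smoothM f g : smooth f -> smooth g -> smooth (fun x => f x * g x).
Proof. by move=> sf sg k; exact: class_CM. Qed.

Lemma smoothN f : smooth f -> smooth (fun x => - f x).
Proof.
move=> sf; rewrite (_ : (fun _ => _) = (fun x => -1 * f x)).
  exact/smoothM/sf/smooth_cst.
by apply/funext => x; rewrite mulN1r.
Qed.

Lemma smooth_sum (I : Type) (r : seq I) (F : I -> 'rV[R]_n -> R) :
  (forall j, smooth (F j)) -> smooth (fun x => \sum_(j <- r) F j x).
Proof.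
move=> sF; elim: r => [|j r IH].
  by under eq_fun do rewrite big_nil; exact: smooth_cst.
by under eq_fun do rewrite big_cons; exact: smoothD.
Qed.

Lemma partial_sum (I : Type) (r : seq I) (F : I -> 'rV[R]_n -> R) i :
  (forall j, smooth (F j)) ->
  partial i (fun x => \sum_(j <- r) F j x) = fun x => \sum_(j <- r) partial i (F j) x.
Proof.
move=> sF; elim: r => [|j r IH].
  rewrite (_ : (fun _ => _) = fun=> 0); last by apply/funext => x; rewrite big_nil.
  by rewrite partial_cst; apply/funext => x; rewrite big_nil.
rewrite (_ : (fun _ => _) = fun x => F j x + \sum_(j <- r) F j x); last first.
  by apply/funext => x; rewrite big_cons.
rewrite partialD; last 2 first.
- by move=> x; exact: smooth_derivable.
- by move=> x; apply: smooth_derivable; exact: smooth_sum.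
by rewrite IH; apply/funext => x; rewrite big_cons.
Qed.

(** For q = f^(-1/2) one has d_i q = - q^3 d_i f / 2: the derivatives of q are
    polynomials in q and those of f, so the smoothness of q bootstraps. *)
Lemma smooth_isqrt f : (forall x, 0 < f x) -> smooth f ->
  smooth (fun x => (Num.sqrt (f x))^-1) /\
  forall i, partial i (fun x => (Num.sqrt (f x))^-1) =
    fun x => - 2^-1 * ((Num.sqrt (f x))^-1) ^+ 3 * partial i f x.
Proof.
move=> f0 sf; pose q x := (Num.sqrt (f x))^-1.
have dq (i : 'I_n) x : is_derive x 'e_i q (- 2^-1 * q x ^+ 3 * partial i f x).
  apply: is_derive_isqrt => //; exact: smooth_derivable.
have pq (i : 'I_n) : partial i q = fun x => - 2^-1 * q x ^+ 3 * partial i f x.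
  by apply/funext => x; rewrite /partial (@derive_val _ _ _ _ _ _ _ (dq i x)).
split=> // k; elim: k => [|k IH]; have cq : continuous q.
- move=> x; apply: (@continuousV _ _ (fun y => Num.sqrt (f y))).
    by rewrite gt_eqF // sqrtr_gt0.
  by apply: continuous_comp; [exact: smooth_continuous|exact: sqrt_continuous].
- by split.
- exact: class_C_continuous IH.
split=> // i; split; first by move=> x; exact: (@ex_derive _ _ _ _ _ _ _ (dq i x)).
rewrite pq; apply: class_CM; last exact: smooth_partial.
apply: class_CM; first exact: class_C_cst.
rewrite (_ : (fun _ => _) = fun x => q x * (q x * q x)).
  by do 2 apply: class_CM => //.
by apply/funext => x; rewrite exprS expr2.
Qed.

End partials.

(** * Continuous partial derivatives: differential, symmetry, constancy *)

Lemma is_derive_translate (R : realType) (V W : normedModType R) (f : V -> W) x v c d :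
  is_derive (x + c) v f d -> is_derive x v (fun y => f (y + c)) d.
Proof.
have E : (fun h : R => h^-1 *: (((fun y => f (y + c)) \o shift x) (h *: v) - f (x + c)))
   = (fun h : R => h^-1 *: ((f \o shift (x + c)) (h *: v) - f (x + c))).
  by apply/funext => h /=; rewrite addrA.
by move=> [df <-]; apply: DeriveDef; rewrite /derivable /derive E.
Qed.

Lemma twice_quarter_lt (R : realFieldType) (m : R) : 0 < m -> 2 * (m / 4) < m.
Proof. lra. Qed.

Section differential.
Variables (R : realType) (n : nat).
Implicit Types (f : 'rV[R]_n -> R) (i : 'I_n).

Lemma is_derive_coord i (x v : 'rV[R]_n) :
  is_derive x v (fun y : 'rV[R]_n => y 0 i) (v 0 i).
Proof.
have dx : derivable (id : 'rV[R]_n -> 'rV[R]_n) x v by exact: derivable_id.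
apply: DeriveDef; first by move/derivable_mxP : dx; apply.
by move: (derive_mx dx); rewrite derive_id => /rowP/(_ i); rewrite mxE => ->.
Qed.

Lemma smooth_coord i : smooth (fun x : 'rV[R]_n => x 0 i).
Proof.
have p (j : 'I_n) : partial j (fun x : 'rV[R]_n => x 0 i) = fun=> ('e_j : 'rV[R]_n) 0 i.
  by apply/funext => x; apply: derive_val; exact: is_derive_coord.
case=> [|k]; split=> //; try exact: coord_continuous.
move=> j; split=> [x|]; last by rewrite p; exact: class_C_cst.
exact: (@ex_derive _ _ _ _ _ _ _ (is_derive_coord _ _ _)).
Qed.

Definition linear_form (g h : 'rV[R]_n) : R := dot h g.

Let linear_form_linear g : linear (linear_form g).
Proof.
move=> a x y; rewrite /linear_form /dot scaler_sumr -big_split.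
by apply: eq_bigr => i _; rewrite !mxE mulrDl scalerAl.
Qed.

HB.instance Definition _ g :=
  GRing.isLinear.Build R 'rV[R]_n R _ (linear_form g) (linear_form_linear g).

Lemma linear_form_continuous g : continuous (linear_form g).
Proof.
apply: smooth_continuous; apply: smooth_sum => i.
by apply: smoothM; [exact: smooth_coord|exact: smooth_cst].
Qed.

Lemma coord_le_norm (x : 'rV[R]_n) i : `|x 0 i| <= `|x|.
Proof. by rewrite [leRHS]/Num.Def.normr /= mx_normrE; exact: (le_bigmax _ _ (0, i)). Qed.

Lemma rV_norm_le (x : 'rV[R]_n) (e : R) : 0 <= e ->
  (forall i, `|x 0 i| <= e) -> `|x| <= e.
Proof.
move=> e0 xe; rewrite [leLHS]/Num.Def.normr /= mx_normrE bigmax_le // => -[a i] _.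
by rewrite ord1.
Qed.

(** The points [x + trunc k h], for k = 0, ..., n, are the vertices of a path from
    [x] to [x + h] whose edges are parallel to the axes. *)
Let trunc (k : nat) (h : 'rV[R]_n) : 'rV[R]_n :=
  \row_i (if (i < k)%N then h 0 i else 0).

Let truncS (i : 'I_n) h : trunc i.+1 h = trunc i h + h 0 i *: 'e_i.
Proof.
apply/rowP => j; rewrite !mxE ltnS leq_eqVlt -val_eqE /=.
have [->|ji] := eqVneq j i; first by rewrite !eqxx ltnn mulr1 add0r.
have -> : ((j : nat) == i) = false by exact: negbTE.
by rewrite mulr0 addr0.
Qed.

Let telescope_path f (x h : 'rV[R]_n) :
  f (x + h) - f x = \sum_(i < n) (f (x + trunc i.+1 h) - f (x + trunc i h)).
Proof.
rewrite -(big_mkord xpredT (fun k => f (x + trunc k.+1 h) - f (x + trunc k h))).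
rewrite (telescope_sumr (fun k => f (x + trunc k h))) //; congr (f _ - f _).
  by congr (_ + _); apply/rowP => i; rewrite mxE ltn_ord.
by rewrite -[LHS]addr0; congr (_ + _); apply/rowP => i; rewrite !mxE.
Qed.

(** On each edge of the path the mean value theorem gives the increment as h_i
    times a partial derivative at a point as close to [x] as [x + h] is; by
    continuity it differs little from the one at [x]. *)
Lemma C1_differential f x : class_C 1 f ->
  differentiable f x /\ 'd f x = linear_form (grad f x) :> ('rV[R]_n -> R).
Proof.
move=> [cf df]; have dfc := @linear_form_continuous (grad f x).
suff E : f \o shift x = cst (f x) + linear_form (grad f x) +o_ 0 id.
  have dE := diff_unique dfc E; split=> //; apply/diff_locallyP.
  by rewrite dE.
apply/eqaddoP => _/posnumP[e].
(* each of the n edges is allowed the error e |h| / (n + 1); this is meaningful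
   for n = 0 as well *)
have n0 : 0 < (n.+1%:R : R) by [].
have e0 : 0 < e%:num / n.+1%:R :> R by [].
have close : \forall h \near (0 : 'rV[R]_n), forall i y, `|y - x| <= `|h| ->
    `|partial i f y - partial i f x| <= e%:num / n.+1%:R.
  apply: (@filter_forall _ _ (fun i (h : 'rV[R]_n) => forall y, `|y - x| <= `|h| ->
    `|partial i f y - partial i f x| <= e%:num / n.+1%:R) _ (nbhs_filter _)) => i.
  have [_ [cpf _]] := df i.
  have /cvgrPdist_le /(_ _ e0) := cpf x.
  move=> /nbhs_ballP[d /= d0 xd]; apply/nbhs_ballP; exists d => //= h hd y yx.
  rewrite distrC; apply: xd; rewrite -ball_normE /ball_ /= distrC (le_lt_trans yx) //.
  by move: hd; rewrite -ball_normE /ball_ /= sub0r normrN.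
near=> h.
have hclose : forall i y, `|y - x| <= `|h| ->
    `|partial i f y - partial i f x| <= e%:num / n.+1%:R by near: h.
rewrite -[(_ - _) h]/(f (h + x) - (f x + dot h (grad f x))) /= opprD addrA.
rewrite (addrC h) telescope_path /dot -sumrB.
apply: le_trans (ler_norm_sum _ _ _) _.
have -> : e%:num * `|h| = \sum_(i < n.+1) (e%:num / n.+1%:R * `|h|).
  rewrite sumr_const card_ord -mulr_natl; field; exact: lt0r_neq0.
rewrite big_ord_recr /= -[leLHS]addr0 lerD ?mulr_ge0 //.
apply: ler_sum => i _; rewrite truncS addrA !mxE.
have [t /andP[t0 t1] ->] := MVT_line (x + trunc i h) (h 0 i) (df i).1.
rewrite -mulrBr normrM mulrC; apply: ler_pM => //; last exact: coord_le_norm.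
apply: hclose.
rewrite -(addrA x) (addrC x) addrK; apply: rV_norm_le => // j.
rewrite !mxE; have := coord_le_norm h j.
have [ji|ij|/val_inj ->] := ltngtP j i => hj /=.
- by rewrite (_ : j == i = false) ?mulr0 ?addr0 // -val_eqE /= ltn_eqF.
- by rewrite (_ : j == i = false) ?mulr0 ?addr0 ?normr0 // -val_eqE /= gtn_eqF.
- rewrite eqxx mulr1 add0r normrM (le_trans _ hj) // ger0_norm //.
  by rewrite ler_piMl.
Unshelve. all: by end_near. Qed.

Lemma derive_grad f x v : class_C 1 f -> 'D_v f x = dot v (grad f x).
Proof. by move=> /(@C1_differential _ x)[df E]; rewrite deriveE // E. Qed.

Lemma grad0_cst f : class_C 1 f -> (forall i x, partial i f x = 0) ->
  forall x y, f x = f y.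
Proof.
move=> Cf pf x y; apply/eqP; rewrite -subr_eq0; apply/eqP.
have -> : f x - f y = f (y + (x - y)) - f y by rewrite (addrC y) subrK.
rewrite telescope_path big1 // => i _.
rewrite truncS addrA; case: Cf => [_ /(_ i) [dfi _]].
have [t _ ->] := MVT_line (y + trunc i (x - y)) ((x - y) 0 i) dfi.
by rewrite [X in _ * X]pf mulr0.
Qed.

(** The second difference of [f] over a square with sides h e_i, h e_j is h^2 times
    a mixed derivative at a point of the square, in either order of
    differentiation. *)
Lemma partialC f i j : class_C 2 f ->
  partial i (partial j f) = partial j (partial i f).
Proof.
move=> Cf; apply/funext => x.
(* the mean value theorem, first for g y = f (y + h e_b) - f y along e_a, then
   for the a-th partial derivative along e_b *)
have mixed (a b : 'I_n) (h : R) : h != 0 -> exists y,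
    `|y - x| <= 2 * `|h| /\
    f (x + h *: 'e_a + h *: 'e_b) - f (x + h *: 'e_a) - f (x + h *: 'e_b) + f x =
      h ^+ 2 * partial b (partial a f) y.
  move=> h0; have [cf df] := Cf; have [dfa [_ /(_ b) [dfab _]]] := df a.
  pose g y := f (y + h *: 'e_b) - f y.
  have dgy y : is_derive y 'e_a g (partial a f (y + h *: 'e_b) - partial a f y).
    apply: is_deriveB; last exact/derivableP/dfa.
    exact/is_derive_translate/derivableP/dfa.
  have [s s01 gE] := @MVT_line _ _ g x 'e_a h (fun y => @ex_derive _ _ _ _ _ _ _ (dgy y)).
  have [t t01 pE] := @MVT_line _ _ (partial a f) (x + (s * h) *: 'e_a) 'e_b h dfab.
  exists (x + (s * h) *: 'e_a + (t * h) *: 'e_b); split; last first.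
    move: gE; rewrite (@derive_val _ _ _ _ _ _ _ (dgy _)) pE mulrA -expr2 => <-.
    by rewrite /g (addrAC x); ring.
  have unit_le c (r : R) : 0 <= r <= 1 -> `|(r * h) *: 'e_c : 'rV[R]_n| <= `|h|.
    move=> /andP[r0 r1]; apply: rV_norm_le => // k; rewrite !mxE /= normrM.
    case: (k == c); last by rewrite normr0 mulr0.
    by rewrite normr1 mulr1 normrM ger0_norm // ler_piMl.
  rewrite -(addrA x) (addrC x) addrK (le_trans (ler_normD _ _)) //.
  by rewrite mulr_natl mulr2n lerD // unit_le.
have cont (a b : 'I_n) : continuous (partial b (partial a f)).
  by have [_ /(_ a) [_ [_ /(_ b) [_ [cab _]]]]] := Cf.
apply/eqP; rewrite -subr_eq0 -normr_le0; apply/ler_addgt0Pl => e e0; rewrite addr0.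
have e2 : 0 < e / 2 by rewrite divr_gt0.
have /cvgrPdist_le /(_ _ e2) /nbhs_ballP[d1 /= d10 xd1] := cont j i x.
have /cvgrPdist_le /(_ _ e2) /nbhs_ballP[d2 /= d20 xd2] := cont i j x.
pose h := Num.min d1 d2 / 4.
have h0 : 0 < h by rewrite divr_gt0 // lt_min d10 d20.
have [y [xy yE]] := mixed j i h (lt0r_neq0 h0).
have [z [xz zE]] := mixed i j h (lt0r_neq0 h0).
have near_x d w : Num.min d1 d2 <= d -> `|w - x| <= 2 * `|h| -> ball x d w.
  move=> hd xw; rewrite -ball_normE /ball_ /= distrC (le_lt_trans xw) //.
  rewrite gtr0_norm //; apply: lt_le_trans hd; apply: twice_quarter_lt.
  by rewrite lt_min d10 d20.
have yzE : partial i (partial j f) y = partial j (partial i f) z.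
  have h2 : h ^+ 2 != 0 by rewrite expf_neq0 // lt0r_neq0.
  have : h ^+ 2 * partial i (partial j f) y = h ^+ 2 * partial j (partial i f) z.
    apply: etrans (esym yE) _; apply: etrans zE.
    by rewrite (addrAC x); congr (_ + _); exact: addrAC.
  by move/(mulfI h2).
have dl : Num.min d1 d2 <= d1 by rewrite ge_min lexx.
have dr : Num.min d1 d2 <= d2 by rewrite ge_min lexx orbT.
have := xd1 y (near_x _ _ dl xy); have := xd2 z (near_x _ _ dr xz); rewrite yzE /=.
move=> hz hy; apply: le_trans (ler_distD (partial j (partial i f) z) _ _) _.
by rewrite (splitr e); apply: lerD; [exact: hy|rewrite distrC; exact: hz].
Qed.

End differential.

(** * Integration on tuples *)

Section tuples.
Variable R : realType.
Local Notation T := (measurableTypeR R).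

Definition row_of_tuple n (t : n.-tuple T) : 'rV[R]_n := \row_i tnth t i.

(** The sigma-algebra on tuples is generated by the coordinates, so open boxes are
    measurable; an open set is the union of the countably many boxes with
    rational centre and radius 1 / (k + 1) that it contains. *)
Lemma measurable_row_open n (U : set 'rV[R]_n) : open U ->
  measurable (@row_of_tuple n @^-1` U).
Proof.
move=> oU.
pose box (q : 'rV[rat]_n) (k : nat) : set (n.-tuple T) :=
  \bigcap_(i in [set: 'I_n])
    ((fun t => tnth t i) @^-1`
       [set` `]ratr (q 0 i) - k.+1%:R^-1, ratr (q 0 i) + k.+1%:R^-1[]).
pose good q k := box q k `<=` @row_of_tuple n @^-1` U.
have mbox q k : measurable (box q k).
  apply: fin_bigcap_measurable => [|i _]; first exact: finite_finset.
  by rewrite -[X in measurable X]setTI; apply: measurable_tnth.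
pose F (p : 'rV[rat]_n * nat) := if `[< good p.1 p.2 >] then box p.1 p.2 else set0.
have -> : @row_of_tuple n @^-1` U = \bigcup_p F p.
  apply/seteqP; split => [t Ut|t [[q k] _]]; last first.
    by rewrite /F; case: asboolP => [+ +|//]; exact.
  have /nbhs_ballP[e /= e0 teU] : nbhs (row_of_tuple t) U by exact: open_nbhs_nbhs.
  pose k := Num.truncn (2 / e); have k0 : 0 < k.+1%:R^-1 :> R by rewrite invr_gt0.
  have ke : k.+1%:R^-1 < e / 2 :> R.
    by rewrite -[ltRHS]invf_div ltf_pV2 ?posrE ?divr_gt0 // truncnS_gt.
  have /choice[q qP] : forall i : 'I_n, exists q : rat,
      ratr q \in `]tnth t i - k.+1%:R^-1, tnth t i + k.+1%:R^-1[.
    move=> i; have /rat_in_itvoo[q qP] : tnth t i - k.+1%:R^-1 < tnth t i + k.+1%:R^-1.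
      by rewrite ltrD2l gtrN.
    by exists q.
  have dist i : `|ratr (q i) - tnth t i| < k.+1%:R^-1.
    by have := qP i; rewrite in_itv /= -ltr_distlC distrC.
  exists (\row_i q i, k) => //; rewrite /F /=; case: asboolP => [_ i _|].
    by rewrite /= in_itv /= mxE -ltr_distlC.
  case=> s sbox; apply: teU; rewrite -ball_normE /ball_ /=.
  apply: (@le_lt_trans _ _ (2 * k.+1%:R^-1)); last by rewrite mulrC -ltr_pdivlMr.
  apply: rV_norm_le => [|i]; first by rewrite mulr_ge0 // ltW.
  rewrite !mxE; have := sbox i Logic.I; rewrite /= in_itv /= mxE -ltr_distlC => si.
  rewrite (le_trans (ler_distD (ratr (q i)) _ _)) // mulr_natl mulr2n.
  by rewrite lerD // ltW // distrC.
apply: countable_bigcupT_measurable; first exact: countableP.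
by move=> p; rewrite /F; case: ifP.
Qed.

Lemma continuous_measurable_row n (g : 'rV[R]_n -> R) : continuous g ->
  measurable_fun setT (g \o @row_of_tuple n : n.-tuple T -> R).
Proof.
move=> /continuousP cg; apply: (measurability _ (RGenOpens.measurableE R)).
move=> _ [_ [a [b ->] <-]]; rewrite setTI comp_preimage.
by apply: measurable_row_open; apply: cg; exact: interval_open.
Qed.

(** A real-valued indicator, so that it factors along [cons_pair] and can be
    multiplied with integrands. *)
Definition box n (A : 'I_n -> set R) (t : n.-tuple T) : R :=
  \prod_i \1_(A i) (tnth t i).

Lemma measurable_box n (A : 'I_n -> set R) : (forall i, measurable (A i)) ->
  measurable_fun setT (box A).
Proof.
move=> mA; apply: measurable_prod => i _.
apply: measurableT_comp; last exact: measurable_tnth.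
apply: measurable_indic; exact: mA.
Qed.

Lemma box_ge0 n (A : 'I_n -> set R) t : 0 <= box A t.
Proof. by apply: prodr_ge0 => i _; rewrite indicE. Qed.

Lemma boxE n (A : 'I_n -> set R) t :
  box A t = (`[< forall i, A i (tnth t i) >])%:R.
Proof.
rewrite /box; case: asboolP => [At|nAt].
  by rewrite big1 // => i _; rewrite indicE mem_set.
have /existsNP[i nAi] := nAt; rewrite (bigD1 i) //= indicE memNset // mul0r //.
Qed.

Lemma box_cons n (A : 'I_n.+1 -> set R) x (t : n.-tuple T) :
  box A (cons_pair (x, t)) = \1_(A ord0) x * box (A \o lift ord0) t.
Proof.
rewrite /box big_ord_recl (tnth_nth x) /=; congr (_ * _).
by apply: eq_bigr => i _; rewrite (tnth_nth x) /= -tnth_nth.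
Qed.

Local Open Scope ereal_scope.
Local Notation mu n := (lebesgue_tuple R n).

Lemma measurable_cons_pair n : measurable_fun setT (@cons_pair T n).
Proof. exact: (@measurable_cons _ _ (T * n.-tuple T)%type T fst n snd). Qed.

Lemma tonelli_cons n (h : n.+1.-tuple T -> \bar R) :
  measurable_fun setT h -> (forall t, 0 <= h t) ->
  \int[mu n.+1]_t h t =
    \int[lebesgue_measure]_x \int[mu n]_t h (cons_pair (x, t)).
Proof.
move=> mh h0.
rewrite [LHS](ge0_integral_pushforward (@measurable_cons_pair n)) //.
rewrite preimage_setT fubini_tonelli1 //=.
by apply: measurableT_comp => //; exact: measurable_cons_pair.
Qed.

Lemma integrable_cons n (h : n.+1.-tuple T -> \bar R) :
  (mu n.+1).-integrable setT h ->
  (@lebesgue_measure R \x mu n).-integrable setT (h \o @cons_pair T n).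
Proof.
move=> /integrableP[mh hoo]; apply/integrableP; split.
  by apply: measurableT_comp => //; exact: measurable_cons_pair.
move: hoo; rewrite (ge0_integral_pushforward (@measurable_cons_pair n)) //.
by apply: measurableT_comp.
Qed.

(** The two orders of integration are both needed: [fubini_cons1] leaves an
    integral over the last n variables, to which an induction hypothesis applies;
    [fubini_cons2] has the first variable innermost. *)
Lemma fubini_cons1 n (h : n.+1.-tuple T -> \bar R) :
  (mu n.+1).-integrable setT h ->
  \int[mu n.+1]_t h t =
    \int[lebesgue_measure]_x \int[mu n]_t h (cons_pair (x, t)).
Proof.
move=> ih; have ihc := integrable_cons ih; have /integrableP[mh _] := ih.
rewrite [LHS](integral_pushforward (@measurable_cons_pair n)) //.
by rewrite preimage_setT -integral12_prod_meas1.
Qed.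

Lemma fubini_cons2 n (h : n.+1.-tuple T -> \bar R) :
  (mu n.+1).-integrable setT h ->
  \int[mu n.+1]_t h t =
    \int[mu n]_t \int[lebesgue_measure]_x h (cons_pair (x, t)).
Proof.
move=> ih; have ihc := integrable_cons ih; have /integrableP[mh _] := ih.
rewrite [LHS](integral_pushforward (@measurable_cons_pair n)) //.
by rewrite preimage_setT -integral21_prod_meas1.
Qed.

Lemma integral_box n (A : 'I_n -> set R) : (forall i, measurable (A i)) ->
  \int[mu n]_t (box A t)%:E = \prod_i lebesgue_measure (A i).
Proof.
elim: n A => [|n IH] A mA.
  rewrite big_ord0 /= integral_dirac //; last first.
    by apply/measurable_EFinP; exact: measurable_box.
  by rewrite diracT mul1e /box big_ord0.
rewrite tonelli_cons; last 2 first.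
- by apply/measurable_EFinP; exact: measurable_box.
- by move=> t; rewrite lee_fin box_ge0.
rewrite big_ord_recl.
transitivity (\int[lebesgue_measure]_x
    ((\1_(A ord0) x)%:E * \prod_(i < n) lebesgue_measure (A (lift ord0 i)))).
  apply: eq_integral => x _; rewrite -IH => [|i]; last exact: mA.
  rewrite -ge0_integralZl_EFin //; last 2 first.
  - by move=> t _; rewrite lee_fin box_ge0.
  - by apply/measurable_EFinP; apply: measurable_box => i; exact: mA.
  by apply: eq_integral => t _; rewrite box_cons EFinM.
rewrite ge0_integralZr //; last 2 first.
- by apply: measurableT_comp => //; apply: measurable_indic; exact: mA.
- by apply: prode_ge0 => i _; exact: measure_ge0.
congr (_ * _); have := integral_indic (@lebesgue_measure R) measurableT (mA ord0).
by rewrite setIT.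
Qed.

(** Unlike integrability, the domination by a multiple of [box A] passes to all
    slices, not only to almost all of them. *)
Lemma box_bounded_integrable n (A : 'I_n -> set R) (M : R) (h : n.-tuple T -> R) :
  (forall i, measurable (A i)) -> (forall i, lebesgue_measure (A i) < +oo) ->
  measurable_fun setT h -> (forall t, `|h t| <= M * box A t)%R ->
  (mu n).-integrable setT (EFin \o h).
Proof.
move=> mA Aoo mh hM.
apply: (@le_integrable _ _ _ _ _ _ _ (fun t => M%:E * (box A t)%:E)) => //.
- exact/measurable_EFinP.
- by move=> t _; rewrite /= lee_fin (le_trans (hM t)) // ler_norm.
apply: integrableZl => //; apply/integrableP; split.
  by apply/measurable_EFinP; exact: measurable_box.
under eq_integral do rewrite gee0_abs ?lee_fin ?box_ge0 //.
rewrite integral_box //.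
suff [] : 0 <= \prod_i lebesgue_measure (A i) /\
    \prod_i lebesgue_measure (A i) < +oo by [].
elim/big_ind : _ => [|x y [x0 xoo] [y0 yoo]|i _]; first by rewrite lee01 ltry.
  by rewrite mule_ge0 // lte_mul_pinfty // ge0_fin_numE.
by split; [exact: measure_ge0|exact: Aoo].
Qed.

Lemma tnth_cons_lift n x (t : n.-tuple T) k :
  tnth (cons_pair (x, t)) (lift ord0 k) = tnth t k.
Proof. by rewrite (tnth_nth x) /= -tnth_nth. Qed.

Definition tuple_set n (t : n.-tuple T) (i : 'I_n) (s : R) : n.-tuple T :=
  [tuple if j == i then s else tnth t j | j < n].

Lemma tuple_set0 n (t : n.-tuple T) x s :
  tuple_set (cons_pair (x, t)) ord0 s = cons_pair (s, t).
Proof.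
apply: eq_from_tnth => j; rewrite tnth_mktuple.
case: (unliftP ord0 j) => [k ->|->]; last by rewrite (tnth_nth s).
by rewrite eq_sym (negPf (neq_lift _ _)) !(tnth_nth s).
Qed.

Lemma tuple_setS n (t : n.-tuple T) x (i : 'I_n) s :
  tuple_set (cons_pair (x, t)) (lift ord0 i) s = cons_pair (x, tuple_set t i s).
Proof.
apply: eq_from_tnth => j; rewrite tnth_mktuple.
case: (unliftP ord0 j) => [k ->|->].
  by rewrite (inj_eq lift_inj) !tnth_cons_lift tnth_mktuple.
by rewrite (negPf (neq_lift _ _)) !(tnth_nth s).
Qed.

(** Fubini with the i-th variable innermost. *)
Lemma integral_line0 n (i : 'I_n) (A : 'I_n -> set R) (M : R) (h : n.-tuple T -> R) :
  (forall j, measurable (A j)) -> (forall j, lebesgue_measure (A j) < +oo) ->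
  measurable_fun setT h -> (forall t, `|h t| <= M * box A t)%R ->
  (forall t, \int[lebesgue_measure]_s (h (tuple_set t i s))%:E = 0) ->
  \int[mu n]_t (h t)%:E = 0.
Proof.
elim: n i A M h => [|n IH] i A M h mA Aoo mh hM h0; first by case: i h0.
have ih := box_bounded_integrable mA Aoo mh hM.
case: (unliftP ord0 i) h0 => [j ->|->] h0.
  rewrite (fubini_cons1 ih) integral0_eq // => x _.
  apply: (IH j (A \o lift ord0) (`|M| * \1_(A ord0) x)%R
    (fun t => h (cons_pair (x, t)))).
  - by move=> k; exact: mA.
  - by move=> k; exact: Aoo.
  - apply: (measurableT_comp mh).
    apply: (measurableT_comp (@measurable_cons_pair n)).
    exact: measurable_pair1.
  - move=> t; rewrite (le_trans (hM _)) // box_cons mulrA ler_wpM2r ?box_ge0 //.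
    by rewrite ler_wpM2r ?ler_norm // indicE.
  - move=> t; rewrite -[RHS](h0 (cons_pair (x, t))).
    by apply: eq_integral => s _; rewrite tuple_setS.
rewrite (fubini_cons2 ih) integral0_eq // => t _.
rewrite -[RHS](h0 (cons_pair (0%R, t))).
by apply: eq_integral => s _; rewrite tuple_set0.
Qed.

End tuples.

(** * Integrable vector fields with divergence of constant sign *)

Section divergence.
Variables (R : realType) (n : nat).
Local Notation T := (measurableTypeR R).
Local Notation mu := (lebesgue_tuple R n).
Implicit Types (g : 'rV[R]_n -> R) (i : 'I_n) (x a : 'rV[R]_n) (r : R).

Definition cube a r : 'I_n -> set R := fun i => `[a 0 i - r, a 0 i + r]%classic.

Lemma lebesgue_cube a r i : 0 < r -> lebesgue_measure (cube a r i) = (r *+ 2)%:E.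
Proof.
move=> r0; rewrite /cube lebesgue_measure_itv /= lte_fin.
rewrite ifT; last by lra.
by rewrite -EFinD; congr EFin; rewrite mulr2n; ring.
Qed.

Lemma cube_measurable a r i : measurable (cube a r i).
Proof. exact: measurable_itv. Qed.

Lemma cube_fin a r i : 0 < r -> (lebesgue_measure (cube a r i) < +oo)%E.
Proof. by move=> r0; rewrite lebesgue_cube // ltry. Qed.

Lemma cube_boundedP g a r : continuous g ->
  exists M, forall t : n.-tuple T,
    `|box (cube a r) t * g (row_of_tuple t)| <= M * box (cube a r) t.
Proof.
move=> cg.
have : compact (g @` [set v : 'rV[R]_n | forall i, cube a r i (v 0 i)]).
  apply: continuous_compact; first exact: continuous_subspaceT.
  by apply: rV_compact => i; exact: segment_compact.
move=> /compact_bounded [M0 [_ bM]]; exists (`|M0| + 1) => t.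
rewrite boxE; case: asboolP => [tQ|_]; last by rewrite mul0r mulr0 normr0.
rewrite mul1r mulr1; apply: (bM (`|M0| + 1)).
  by rewrite (le_lt_trans (ler_norm _)) // ltrDl.
by exists (row_of_tuple t) => //= i; rewrite mxE.
Qed.

Lemma measurable_cube_mul g a r : continuous g ->
  measurable_fun setT (fun t : n.-tuple T => box (cube a r) t * g (row_of_tuple t)).
Proof.
move=> cg; apply: measurable_funM; last exact: continuous_measurable_row.
by apply: measurable_box => i; exact: cube_measurable.
Qed.

Lemma cube_integrable g a r : 0 < r -> continuous g ->
  mu.-integrable setT
    (EFin \o (fun t : n.-tuple T => box (cube a r) t * g (row_of_tuple t))).
Proof.
move=> r0 cg; have [M MP] := cube_boundedP a r cg.
apply: box_bounded_integrable MP; last exact: measurable_cube_mul.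
- by move=> i; exact: cube_measurable.
- by move=> i; exact: cube_fin.
Qed.

Lemma integrable_cube a r : 0 < r ->
  mu.-integrable setT (EFin \o (box (cube a r) : n.-tuple T -> R)).
Proof.
move=> r0; have := @cube_integrable (fun=> 1) a r r0 (@cst_continuous _ _ _).
by apply: eq_integrable => // t _; rewrite /= mulr1.
Qed.

Lemma Rintegral_cube a r : 0 < r ->
  \int[mu]_t (box (cube a r) t : R) = (r *+ 2) ^+ n.
Proof.
move=> r0; rewrite /Rintegral integral_box => [|i]; last exact: cube_measurable.
under eq_bigr do rewrite lebesgue_cube //.
by rewrite prodEFin /= prodr_const card_ord.
Qed.

Lemma row_tuple_set (t : n.-tuple T) i s :
  row_of_tuple (tuple_set t i s) = row_of_tuple (tuple_set t i 0) + s *: 'e_i.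
Proof.
apply/rowP => j; rewrite !mxE !tnth_mktuple /=.
by case: eqP => _; rewrite ?mulr1 ?mulr0 ?add0r ?addr0.
Qed.

Lemma box_tuple_set (A : 'I_n -> set R) (t : n.-tuple T) i s :
  box A (tuple_set t i s) = \1_(A i) s * \prod_(j | j != i) \1_(A j) (tnth t j).
Proof.
rewrite /box (bigD1 i) //= tnth_mktuple eqxx; congr (_ * _).
by apply: eq_bigr => j /negPf ji; rewrite tnth_mktuple ji.
Qed.

Lemma is_derive_scaled_line g i c x (s : R) : smooth g ->
  is_derive s 1 (fun s : R => c * g (x + s *: 'e_i)) (c * partial i g (x + s *: 'e_i)).
Proof.
move=> sg; apply: is_deriveZ; apply: is_derive_line; exact: smooth_derivable.
Qed.

Lemma line_continuous g i c x : smooth g ->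
  continuous (fun s : R => c * g (x + s *: 'e_i)).
Proof.
move=> sg s; apply: differentiable_continuous; apply/derivable1_diffP.
exact: (@ex_derive _ _ _ _ _ _ _ (is_derive_scaled_line i c x s sg)).
Qed.

(** The fundamental theorem of calculus on the segments parallel to e_i: the
    boundary values vanish. *)
Lemma integral_partial0 g i r : 0 < r -> smooth g ->
  (forall x, `|x 0 i| = r -> g x = 0) ->
  \int[mu]_t (box (cube 0 r) t * partial i g (row_of_tuple t)) = 0.
Proof.
move=> r0 sg g0; rewrite /Rintegral.
have cpg : continuous (partial i g) by exact/smooth_continuous/smooth_partial.
have [M MP] := cube_boundedP 0 r cpg.
rewrite (@integral_line0 _ _ i _ M _ _ _ _ MP) //; last 4 first.
- by move=> j; exact: cube_measurable.
- by move=> j; exact: cube_fin.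
- exact: measurable_cube_mul.
move=> t; pose c : R := \prod_(j | j != i) \1_(cube 0 r j) (tnth t j).
pose x0 := row_of_tuple (tuple_set t i 0).
pose F (s : R) := c * g (x0 + s *: 'e_i).
have dF s := is_derive_scaled_line i c x0 s sg.
have cF : continuous F by exact: line_continuous.
have F0 s : `|s| = r -> F s = 0.
  move=> sr; rewrite /F g0 ?mulr0 // !mxE tnth_mktuple !eqxx /= add0r mulr1.
  exact: sr.
have [Fr FNr] : F r = 0 /\ F (- r) = 0.
  by split; apply: F0; rewrite ?normrN gtr0_norm.
have E : (\int[lebesgue_measure]_(s in `[(- r)%R, r]%classic)
    (c * partial i g (x0 + s *: 'e_i))%:E = 0)%E.
  transitivity ((F r)%:E - (F (- r)%R)%:E)%E; last by rewrite Fr FNr subee.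
  apply: continuous_FTC2.
  - lra.
  - apply: continuous_subspaceT; apply: line_continuous; exact: smooth_partial.
  - split.
    + by move=> s _; exact: (@ex_derive _ _ _ _ _ _ _ (dF s)).
    + exact/cvg_at_right_filter/cF.
    + exact/cvg_at_left_filter/cF.
  - by move=> s _; rewrite derive1E; apply: derive_val; exact: dF.
rewrite -[RHS]E [RHS]integral_mkcond; apply: eq_integral => s _.
rewrite box_tuple_set -/c row_tuple_set -/x0 patchE /cube mxE !add0r indicE.
by case: ifPn => _; rewrite ?mul1r ?mul0r.
Qed.

(** The cutoff function is the product of the 1 - (x_j / r)^2. It vanishes on the
    faces of the cube [-r, r]^n, so that integrations by parts over the cube have
    no boundary terms; in the cube it lies between 0 and 1 and its partial
    derivatives are bounded by 2 / r. *)
Let factor r (j : 'I_n) x : R := 1 - (r^-1 * x 0 j) * (r^-1 * x 0 j).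

Let cutoff r x : R := \prod_j factor r j x.

Let smooth_factor r j : smooth (factor r j).
Proof.
have s1 : smooth (fun x : 'rV[R]_n => r^-1 * x 0 j).
  by apply: smoothM; [exact: smooth_cst|exact: smooth_coord].
by apply: smoothD; [exact: smooth_cst|apply: smoothN; exact: smoothM].
Qed.

Lemma smooth_prod (I : Type) (s : seq I) (P : pred I) (F : I -> 'rV[R]_n -> R) :
  (forall j, smooth (F j)) -> smooth (fun x => \prod_(j <- s | P j) F j x).
Proof.
move=> sF; elim: s => [|j s IH].
  by under eq_fun do rewrite big_nil; exact: smooth_cst.
under eq_fun do rewrite big_cons; case: (P j) => //; exact: smoothM.
Qed.

Let smooth_cutoff r : smooth (cutoff r).
Proof. exact: smooth_prod. Qed.

Lemma partial_indep g i : (forall x s, g (x + s *: 'e_i) = g x) ->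
  partial i g = fun=> 0.
Proof.
move=> gi; apply/funext => x; rewrite /partial /derive.
under eq_fun do rewrite /= [_ + x]addrC gi subrr scaler0.
exact: lim_cst.
Qed.

Let partial_cutoff r i x :
  partial i (cutoff r) x =
  - (2 * r^-1 * (r^-1 * x 0 i)) * \prod_(j | j != i) factor r j x.
Proof.
pose rest x := \prod_(j | j != i) factor r j x.
have srest : smooth rest by exact: smooth_prod.
have -> : cutoff r = fun x => factor r i x * rest x.
  by apply/funext => y; rewrite /cutoff (bigD1 i).
rewrite partialM; last 2 first.
- by move=> y; exact/smooth_derivable.
- by move=> y; exact: smooth_derivable.
rewrite (@partial_indep rest); last first.
  move=> y s; apply: eq_bigr => j /negPf ji; rewrite /factor !mxE ji /= mulr0 addr0.
  by [].
rewrite mulr0 add0r mulrC; congr (_ * _).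
have dx := is_derive_coord i x 'e_i.
pose b := r^-1 * ('e_i : 'rV[R]_n) 0 i.
have dl : is_derive x 'e_i (fun y : 'rV[R]_n => r^-1 * y 0 i) b.
  exact: is_deriveZ.
have df : is_derive x 'e_i (factor r i)
    (0 - ((r^-1 * x 0 i) *: b + (r^-1 * x 0 i) *: b)).
  apply: is_deriveB; exact: is_deriveM.
rewrite /partial (@derive_val _ _ _ _ _ _ _ df) /b !mxE !eqxx /= /GRing.scale /=; ring.
Qed.

Let scaled_le r i x b : 0 < r -> `|x 0 i| <= r * b -> - b <= r^-1 * x 0 i <= b.
Proof.
move=> r0 xr; rewrite -ler_norml normrM gtr0_norm ?invr_gt0 //.
by rewrite mulrC ler_pdivrMr // mulrC.
Qed.

Let factor01 r i x : 0 < r -> `|x 0 i| <= r -> 0 <= factor r i x <= 1.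
Proof.
move=> r0 xr; have := @scaled_le r i x 1 r0; rewrite mulr1 => /(_ xr).
rewrite /factor; move: (_ * x 0 i) => y /andP[y1 y2]; apply/andP; split; nra.
Qed.

Let partial_cutoff_le r i x : 0 < r -> (forall j, `|x 0 j| <= r) ->
  `|partial i (cutoff r) x| <= 2 / r.
Proof.
move=> r0 xr; rewrite partial_cutoff normrM normrN -[leRHS]mulr1.
apply: ler_pM => //.
  have r2 : 0 < 2 / r by rewrite divr_gt0.
  rewrite normrM (gtr0_norm r2) -[leRHS]mulr1; apply: ler_wpM2l; first exact: ltW.
  by rewrite ler_norml; apply: scaled_le; rewrite ?mulr1.
rewrite ger0_norm; last by apply: prodr_ge0 => j _; have /andP[] := factor01 r0 (xr j).
by apply: prodr_ile1 => j _; exact: factor01.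
Qed.

Let cutoff_ge r x : 0 < r -> (forall j, `|x 0 j| <= r / 2) ->
  2^-1 ^+ n <= cutoff r x.
Proof.
move=> r0 xr; rewrite /cutoff -[X in _ ^+ X]card_ord -prodr_const.
apply: ler_prod => j _; rewrite invr_ge0 ler0n /=.
have /andP[] := @scaled_le r j x _ r0 (xr j).
rewrite /factor; move: (_ * x 0 j) => y y1 y2; nra.
Qed.

Let face r i x : 0 < r -> `|x 0 i| = r -> cutoff r x = 0.
Proof.
move=> r0 xr; rewrite /cutoff (bigD1 i) //= /factor.
suff -> : 1 - r^-1 * x 0 i * (r^-1 * x 0 i) = 0 by rewrite mul0r.
have : (x 0 i) ^+ 2 = r ^+ 2 by rewrite -xr real_normK // num_real.
move=> E; have -> : r^-1 * x 0 i * (r^-1 * x 0 i) = r ^- 2 * x 0 i ^+ 2.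
  by field; rewrite gt_eqF.
by rewrite E mulVf ?subrr // expf_neq0 // gt_eqF.
Qed.

Lemma row_in_cube a r (t : n.-tuple T) :
  (forall i, cube a r i (tnth t i)) <-> (forall i, `|row_of_tuple t 0 i - a 0 i| <= r).
Proof. by split=> h i; have := h i; rewrite mxE /cube /= in_itv /= ler_distl. Qed.

Lemma Rintegral_sum0 (I : Type) (s : seq I) (h : I -> n.-tuple T -> R) :
  (forall k, mu.-integrable setT (EFin \o h k)) ->
  (forall k, \int[mu]_t h k t = 0) ->
  mu.-integrable setT (EFin \o (fun t => \sum_(k <- s) h k t)) /\
  \int[mu]_t (\sum_(k <- s) h k t) = 0.
Proof.
move=> ih h0; elim: s => [|k s [IHi IH0]].
  rewrite (_ : (fun t => _) = fun=> 0); last by apply/funext => t; rewrite big_nil.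
  split; first exact: integrable0.
  by rewrite /Rintegral integral0_eq.
rewrite (_ : (fun t => _) = fun t => h k t + \sum_(j <- s) h j t); last first.
  by apply/funext => t; rewrite big_cons.
split; last by rewrite RintegralD // h0 IH0 addr0.
exact: (integrableD measurableT (ih k) IHi).
Qed.

(** Suppose that the divergence D is positive at [a], say at least e on a small cube
    around [a]. Integrating by parts against the cutoff f of the cube of half-side
    r, the integral of f D equals minus that of the sum of the X_i d_i f, so it is
    at most (2 n / r) times the integral of [G], which tends to 0 with 1 / r. But
    it is at least e / 2^n times the volume of the small cube. *)
Theorem divergence_L1 (X : 'I_n -> 'rV[R]_n -> R) (G : 'rV[R]_n -> R) :
  (forall i, smooth (X i)) -> L1 G -> (forall x, 0 <= G x) ->
  (forall i x, `|X i x| <= G x) ->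
  (forall x, 0 <= \sum_i partial i (X i) x) ->
  forall x, \sum_i partial i (X i) x = 0.
Proof.
move=> sX iG G0 XG div0 a; apply/eqP; rewrite eq_le div0 andbT leNgt.
apply/negP => diva.
pose D x := \sum_i partial i (X i) x; pose e := D a / 2.
have e0 : 0 < e by rewrite divr_gt0.
have cD : continuous D.
  by apply: smooth_continuous; apply: smooth_sum => i; exact: smooth_partial.
have [d /= d0 Dd] : exists2 d : R, 0 < d & forall x, `|x - a| <= d -> e <= D x.
  have /cvgrPdist_le /(_ _ e0) /nbhs_ballP[d /= d0 ad] := cD a.
  exists (d / 2); first by rewrite divr_gt0.
  move=> x xa; have /ad : ball a d x.
    rewrite -ball_normE /ball_ /= distrC (le_lt_trans xa) //.
    by rewrite ltr_pdivrMr // mulr_natr mulr2n ltrDl.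
  by rewrite /= ler_distl => /andP[_]; rewrite /e; move: (D a) (D x) => p q; lra.
pose N := \int[mu]_t G (row_of_tuple t).
(* the lower bound: the cutoff is at least 2^-n on the small cube, of side 2 d *)
pose low := e * 2^-1 ^+ n * (d *+ 2) ^+ n.
have low0 : 0 < low by rewrite !mulr_gt0 ?exprn_gt0 ?mulrn_wgt0 ?invr_gt0.
have key r : 0 < r -> 2 * (`|a| + d) <= r -> low <= 2 / r * n%:R * N.
  move=> r0 ar.
  pose h i (t : n.-tuple T) := box (cube 0 r) t *
    partial i (fun x => cutoff r x * X i x) (row_of_tuple t).
  have sprod i : smooth (fun x => cutoff r x * X i x) by exact: smoothM.
  have [ih h0] : mu.-integrable setT (EFin \o (fun t => \sum_i h i t)) /\
      \int[mu]_t (\sum_i h i t) = 0.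
    apply: Rintegral_sum0 => i.
      by apply: cube_integrable => //; apply: smooth_continuous; exact: smooth_partial.
    by apply: integral_partial0 => // x xr; rewrite (face r0 xr) mul0r.
  have iQ := integrable_cube a d0; have QE := Rintegral_cube a d0.
  rewrite /low -QE -RintegralZl // -[leRHS]add0r -h0.
  have iG' : mu.-integrable setT (EFin \o (fun t => 2 / r * n%:R * G (row_of_tuple t))).
    exact: (integrableZl measurableT _ iG).
  rewrite -RintegralZl // -RintegralD //.
  apply: le_Rintegral => //.
  - exact: (integrableZl measurableT _ iQ).
  - exact: (integrableD measurableT ih iG').
  (* pointwise: e 2^-n on the small cube is at most the sum of the derivatives of
     cutoff * X_i in the large cube, plus the error term with G *)
  move=> t _; rewrite /h; set x := row_of_tuple t.
  have partial_prod i : partial i (fun x => cutoff r x * X i x) x =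
      cutoff r x * partial i (X i) x + X i x * partial i (cutoff r) x.
    by rewrite partialM //= => y; exact: smooth_derivable.
  under eq_bigr do rewrite partial_prod mulrDr.
  rewrite big_split /= -addrA -!mulr_sumr -/(D x).
  have rG0 : 0 <= 2 / r * n%:R * G x by rewrite !mulr_ge0 // invr_ge0 ltW.
  have coord_le k : (forall i, cube a d i (tnth t i)) -> `|x 0 k| <= `|a| + d.
    move=> /row_in_cube /(_ k) xad; rewrite -(subrK (a 0 k) (x 0 k)).
    rewrite (le_trans (ler_normD _ _)) // addrC lerD //; exact: coord_le_norm.
  rewrite !boxE; case: (asboolP (forall i, cube 0 r i (tnth t i))) => [tr|ntr]; last first.
    rewrite !mul0r !add0r; case: asboolP => [tQ|_]; last by rewrite mulr0.
    exfalso; apply: ntr; apply/row_in_cube => k; rewrite [X in _ - X]mxE subr0.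
    rewrite (le_trans (coord_le k tQ)) // (le_trans _ ar) //.
    by rewrite ler_peMl ?addr_ge0 // ?ltW // ltr1n.
  have xr : forall k, `|x 0 k| <= r.
    by move: tr => /row_in_cube tr k; have := tr k; rewrite [X in _ - X]mxE subr0.
  have bound : - (2 / r * n%:R * G x) <= \sum_i X i x * partial i (cutoff r) x.
    rewrite lerNl -sumrN.
    have -> : 2 / r * n%:R * G x = \sum_(i < n) 2 / r * G x.
      by rewrite sumr_const card_ord mulrAC mulr_natr.
    apply: ler_sum => i _; rewrite -mulrN (le_trans (ler_norm _)) // normrM normrN mulrC.
    by apply: ler_pM => //; exact: partial_cutoff_le.
  rewrite !mul1r; apply: (@le_trans _ _ (cutoff r x * D x)); last first.
    by rewrite lerDl -lerBlDr sub0r.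
  have cut0 : 0 <= cutoff r x.
    by apply: prodr_ge0 => j _; have /andP[] := factor01 r0 (xr j).
  case: asboolP => [tQ|_]; last by rewrite mulr0; exact: mulr_ge0 cut0 (div0 x).
  rewrite mulr1 [leLHS]mulrC; apply: ler_pM.
  - by rewrite exprn_ge0.
  - exact: ltW.
  - apply: cutoff_ge => // k; rewrite (le_trans (coord_le k tQ)) //.
    by rewrite ler_pdivlMr // mulrC.
  - apply: Dd; apply: rV_norm_le => [|k]; first exact: ltW.
    by move: tQ => /row_in_cube /(_ k); rewrite !mxE.
have N0 : 0 <= N by apply: Rintegral_ge0 => t _; exact: G0.
(* the second summand makes (2 n / r) N smaller than low *)
pose r := 2 * (`|a| + d) + (2 * n%:R * N / low + 1).
have nN0 : 0 <= 2 * n%:R * N by rewrite !mulr_ge0.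
have ad0 : 0 < 2 * (`|a| + d) by rewrite mulr_gt0 // ltr_wpDl.
have r0 : 0 < r by rewrite addr_gt0 // ltr_wpDl // divr_ge0 // ltW.
have /(key _ r0) : 2 * (`|a| + d) <= r by rewrite lerDl addr_ge0 // divr_ge0 // ltW.
apply/negP; rewrite -ltNge.
have -> : 2 / r * n%:R * N = 2 * n%:R * N / r by rewrite -!mulrA; congr (_ * _); ring.
rewrite ltr_pdivrMr //.
have -> : low * r = low * (2 * (`|a| + d)) + (2 * n%:R * N + low).
  by rewrite /r; field; rewrite gt_eqF.
by rewrite ltr_wpDl ?ltrDl // mulr_ge0 // ltW.
Qed.

End divergence.

(** * The curvatures of a graph as functions of its Gauss map *)

(** The unit normal is extended by a function of the horizontal variables only, so
    its derivative along [Y] is its derivative along the horizontal part of [Y]. *)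
Lemma derive_lsubmx (R : realType) (W : normedModType R) n m
    (f : 'rV[R]_n -> W) (a Y : 'rV[R]_(n + m)) :
  'D_Y (fun p => f (lsubmx p)) a = 'D_(lsubmx Y) f (lsubmx a).
Proof.
have E : (fun h : R => h^-1 *: (((fun p => f (lsubmx p)) \o shift a) (h *: Y)
    - f (lsubmx a))) =
  (fun h : R => h^-1 *: ((f \o shift (lsubmx a)) (h *: lsubmx Y) - f (lsubmx a))).
  apply/funext => h; rewrite /comp /shift; congr (_ *: (f _ - _)).
  by apply/rowP => j; rewrite !mxE.
by rewrite /derive E.
Qed.

Section graph_geometry.
Variables (R : realType) (n : nat) (u : 'rV[R]_n -> R).
Hypothesis su : smooth u.
Implicit Types (x : 'rV[R]_n) (i j k : 'I_n).

(** The area density W of the graph. *)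
Definition area x : R := Num.sqrt (1 + dot (grad u x) (grad u x)).

(** Minus the j-th coordinate of the unit normal. *)
Definition gauss j x : R := partial j u x * (area x)^-1.

Lemma dot_ge0 m (v : 'rV[R]_m) : 0 <= dot v v.
Proof. by apply: sumr_ge0 => i _; rewrite -expr2 sqr_ge0. Qed.

Lemma enorm_sqr m (v : 'rV[R]_m) : enorm v ^+ 2 = dot v v.
Proof. by rewrite sqr_sqrtr // dot_ge0. Qed.

Lemma area_sqr x : area x ^+ 2 = 1 + dot (grad u x) (grad u x).
Proof. by rewrite sqr_sqrtr // addr_ge0 // dot_ge0. Qed.

Let area2_gt0 x : 0 < 1 + dot (grad u x) (grad u x).
Proof. by rewrite ltr_pwDl // dot_ge0. Qed.

Lemma area_gt0 x : 0 < area x.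
Proof. by rewrite sqrtr_gt0. Qed.

Let smooth_area2 : smooth (fun x => 1 + dot (grad u x) (grad u x)).
Proof.
apply: smoothD; first exact: smooth_cst.
rewrite (_ : (fun _ => _) = fun x => \sum_i partial i u x * partial i u x).
  by apply: smooth_sum => i; apply: smoothM; exact: smooth_partial.
by apply/funext => x; apply: eq_bigr => i _; rewrite !mxE.
Qed.

Let partial_area2 i x : partial i (fun x => 1 + dot (grad u x) (grad u x)) x =
  2 * \sum_k Hess u x i k * grad u x 0 k.
Proof.
have s2 k : smooth (fun x => partial k u x * partial k u x).
  by apply: smoothM; exact: smooth_partial.
rewrite (_ : (fun _ => _) = fun x => 1 + \sum_i partial i u x * partial i u x); last first.
  by apply/funext => y; congr (_ + _); apply: eq_bigr => k _; rewrite !mxE.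
rewrite partialD; last 2 first.
- by move=> y; exact: derivable_cst.
- by move=> y; apply: smooth_derivable; exact: smooth_sum.
rewrite partial_cst add0r partial_sum // mulr_sumr; apply: eq_bigr => k _.
by rewrite partialM ?mxE => [|y|y]; try (exact/smooth_derivable/smooth_partial); ring.
Qed.

Lemma smooth_iarea : smooth (fun x => (area x)^-1).
Proof. exact: (smooth_isqrt area2_gt0 smooth_area2).1. Qed.

Lemma partial_iarea i x : partial i (fun x => (area x)^-1) x =
  - (area x)^-1 ^+ 3 * \sum_k Hess u x i k * grad u x 0 k.
Proof.
rewrite (smooth_isqrt area2_gt0 smooth_area2).2 partial_area2 -/(area x).
by move: ((area x)^-1) (\sum_k _) => a b; field.
Qed.

Lemma smooth_gauss j : smooth (gauss j).
Proof. by apply: smoothM; [exact: smooth_partial|exact: smooth_iarea]. Qed.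

Lemma partial_gauss i j x : partial i (gauss j) x =
  (area x)^-1 * (Hess u x i j -
    (area x)^-1 ^+ 2 * (\sum_k Hess u x i k * grad u x 0 k) * grad u x 0 j).
Proof.
rewrite partialM => [|y|y]; last 2 first.
- exact/smooth_derivable/smooth_partial.
- exact/smooth_derivable/smooth_iarea.
by rewrite partial_iarea !mxE; ring.
Qed.

Definition gauss_jacobian x : 'M[R]_n := \matrix_(i, j) partial i (gauss j) x.

Lemma gauss_jacobianE x :
  gauss_jacobian x = graph_shape (grad u x) (Hess u x) (area x).
Proof.
rewrite /graph_shape mulmxBr mulmx1 -scalemxAr mulmxA.
apply/matrixP => i j; rewrite [LHS]mxE partial_gauss exprVn -mulrA.
rewrite [RHS]mxE [X in _ = _ * X]mxE; congr (_ * (_ + _)).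
rewrite [RHS]mxE [X in _ = - X]mxE [X in _ = - (_ * X)]mxE big_ord1; congr (- (_ * (_ * _))).
by rewrite [RHS]mxE; apply: eq_bigr => k _; rewrite [X in _ = _ * X]mxE.
Qed.

Lemma smooth_differentiable (f : 'rV[R]_n -> R) x : smooth f -> differentiable f x.
Proof. by move=> sf; have [] := C1_differential x (sf 1). Qed.

Lemma graph_map_differentiable x : differentiable (graph_map u) x.
Proof.
rewrite (_ : graph_map u = (\sum_(j < n) (fun y : 'rV[R]_n => y 0 j *: row_mx 'e_j 0))
    + (fun y => u y *: row_mx 0 1%:M)); last first.
  apply/funext => y; apply/rowP => k.
  have addE (f g : 'rV[R]_n -> 'rV[R]_(n + 1)) : (f + g) y = f y + g y by [].
  rewrite addE fct_sumE [RHS]mxE summxE [X in _ + X]mxE.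
  have [l ->|l ->] := split_ordP k; rewrite /graph_map ?row_mxEl ?row_mxEr ?[_ 0 l]mxE.
    rewrite mxE mulr0 addr0 (bigD1 l) //= big1 => [|j /negPf jl];
      rewrite mxE row_mxEl mxE eqxx /=.
      by rewrite eqxx mulr1 addr0.
    by rewrite eq_sym jl mulr0.
  rewrite !ord1 !mxE big1 => [|j _]; first by rewrite add0r eqxx mulr1n mulr1.
  by rewrite mxE row_mxEr mxE mulr0.
apply: differentiableD; last exact/differentiableZl/smooth_differentiable.
apply: differentiable_sum => j.
exact/differentiableZl/smooth_differentiable/smooth_coord.
Qed.

Lemma tangent_frameE x : tangent_frame u x = row_mx 1%:M (\col_i partial i u x).
Proof.
apply/row_matrixP => i; rewrite rowE /tangent_frame mul_rV_lin1.
rewrite -deriveE; last exact: graph_map_differentiable.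
rewrite derive_mx; last exact/diff_derivable/graph_map_differentiable.
apply/rowP => k; rewrite [LHS]mxE [RHS]mxE.
have [l ->|l ->] := split_ordP k; rewrite ?row_mxEl ?row_mxEr.
  rewrite (_ : (fun _ => _) = fun y : 'rV[R]_n => y 0 l); last first.
    by apply/funext => y; rewrite /graph_map row_mxEl.
  by rewrite (@derive_val _ _ _ _ _ _ _ (is_derive_coord l x _)) !mxE eqxx eq_sym.
rewrite (_ : (fun _ => _) = u) ?mxE //.
by apply/funext => y; rewrite /graph_map row_mxEr mxE ord1 eqxx.
Qed.

Lemma shape_operatorE i x : shape_operator u x (row i (tangent_frame u x)) =
  row_mx (\row_j partial i (gauss j) x) (- partial i (fun y => (area y)^-1) x)%:M.
Proof.
rewrite /shape_operator tangent_frameE.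
have -> : 'D_(row i (row_mx 1%:M (\col_i partial i u x)))
    (fun p : 'rV[R]_(n + 1) => unit_normal u (lsubmx p)) (graph_map u x) =
    'D_'e_i (unit_normal u) x.
  rewrite (derive_lsubmx (unit_normal u)) /graph_map row_mxKl.
  by rewrite row_row_mx row_mxKl row1.
have NE y : unit_normal u y = row_mx (\row_j - gauss j y) ((area y)^-1)%:M.
  rewrite /unit_normal enorm_sqr -/(area y) scale_row_mx; congr row_mx.
    by apply/rowP => j; rewrite !mxE mulrN mulrC.
  by rewrite scale_scalar_mx mulr1.
have El l : (fun y => unit_normal u y 0 (lshift 1 l)) = fun y => - gauss l y.
  by apply/funext => y; rewrite NE row_mxEl mxE.
have Er l : (fun y => unit_normal u y 0 (rshift n l)) = fun y => (area y)^-1.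
  by apply/funext => y; rewrite NE row_mxEr mxE ord1 eqxx.
have dN : derivable (unit_normal u) x 'e_i.
  apply/derivable_mxP => a k; rewrite ord1; have [l ->|l ->] := split_ordP k.
    by rewrite El; apply/derivableN/smooth_derivable/smooth_gauss.
  by rewrite Er; apply/smooth_derivable/smooth_iarea.
rewrite derive_mx //; apply/rowP => k; rewrite 2!mxE.
have [l ->|l ->] := split_ordP k; rewrite ?row_mxEl ?row_mxEr ?El ?Er.
  by rewrite deriveN ?opprK ?mxE //; exact/smooth_derivable/smooth_gauss.
by rewrite mxE ord1 eqxx.
Qed.

Lemma tangent_frame_free x : row_free (tangent_frame u x).
Proof.
apply/row_freeP; exists (col_mx 1%:M 0).
by rewrite tangent_frameE mul_row_col mulmx1 mulmx0 addr0.
Qed.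

(** The horizontal parts of the tangent frame form the identity matrix, so the
    horizontal part of A(X_i), which is d_i F, lists its coefficients in the
    frame. That A(X_i) is tangent, that is, that the vertical parts agree, comes
    down to W^2 = 1 + |grad u|^2. *)
Lemma shape_matrixE x : shape_matrix u x = gauss_jacobian x.
Proof.
rewrite /shape_matrix.
have -> : \matrix_i shape_operator u x (row i (tangent_frame u x)) =
    gauss_jacobian x *m tangent_frame u x.
  apply/row_matrixP => i; rewrite rowK shape_operatorE tangent_frameE.
  rewrite mul_mx_row mulmx1 row_row_mx; congr row_mx.
    by apply/rowP => j; rewrite !mxE.
  apply/rowP => k; rewrite !mxE ord1 eqxx mulr1n.
  rewrite partial_iarea; set S := \sum_k _.
  have -> : \sum_k gauss_jacobian x i k * (\col_j partial j u x) k 0 =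
      (area x)^-1 * S - (area x)^-1 ^+ 3 * S * dot (grad u x) (grad u x).
    rewrite mulr_sumr [X in _ - X]mulr_sumr -sumrB; apply: eq_bigr => l _.
    rewrite [gauss_jacobian x i l]mxE partial_gauss -/S [(\col_j _) l 0]mxE !mxE; ring.
  have -> : dot (grad u x) (grad u x) = area x ^+ 2 - 1 by rewrite area_sqr addrC addKr.
  by field; rewrite gt_eqF ?area_gt0.
by rewrite -mulmxA mulmxVp ?mulmx1 // tangent_frame_free.
Qed.

Lemma Hess_sym x : (Hess u x)^T = Hess u x.
Proof. by apply/matrixP => i j; rewrite !mxE (partialC i j (su 2)). Qed.

Lemma mean_curvatureE x :
  mean_curvature u x = \tr (gauss_jacobian x) / n%:R.
Proof.
rewrite /mean_curvature /principal_curvatures shape_matrixE gauss_jacobianE.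
by have [-> _] := graph_shape_elem_sym (area_gt0 x) (area_sqr x) (Hess_sym x).
Qed.

Lemma scalar_curvatureE x : scalar_curvature u x =
  (\tr (gauss_jacobian x) ^+ 2 - \tr (gauss_jacobian x *m gauss_jacobian x))
    / (n * n.-1)%N%:R.
Proof.
rewrite /scalar_curvature /principal_curvatures shape_matrixE gauss_jacobianE.
by have [_ ->] := graph_shape_elem_sym (area_gt0 x) (area_sqr x) (Hess_sym x).
Qed.

Lemma gauss_jacobian_sqr_tr0 x :
  \tr (gauss_jacobian x *m gauss_jacobian x) = 0 -> Hess u x = 0.
Proof.
by rewrite gauss_jacobianE; apply: graph_shape_sqr_tr0;
  [exact: area_gt0|exact: area_sqr|exact: Hess_sym].
Qed.

End graph_geometry.

(** * Bounds on the Gauss map and its Jacobian matrix *)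

Lemma coord_le_enorm (R : realType) n (v : 'rV[R]_n) k : `|v 0 k| <= enorm v.
Proof.
rewrite -sqrtr_sqr; apply: ler_wsqrtr; rewrite /dot (bigD1 k) //= -expr2 lerDl.
by apply: sumr_ge0 => j _; rewrite -expr2 sqr_ge0.
Qed.

Section normalized.
Variables (R : realType) (n : nat).
Implicit Types p q : 'rV[R]_n.

Let len p := Num.sqrt (1 + dot p p).

Let len_sqr p : len p ^+ 2 = 1 + dot p p.
Proof. by rewrite sqr_sqrtr // addr_ge0 // dot_ge0. Qed.

Let len_ge1 p : 1 <= len p.
Proof. by rewrite -[leLHS]sqrtr1 ler_wsqrtr // lerDl dot_ge0. Qed.

Let len_gt0 p : 0 < len p. Proof. exact: lt_le_trans (len_ge1 p). Qed.

Let coord_le_len p k : `|p 0 k| <= len p.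
Proof. by rewrite (le_trans (coord_le_enorm p k)) // ler_wsqrtr // lerDr. Qed.

(** |p|^2 - |q|^2 is the sum of the (p_k - q_k) (p_k + q_k), and |p_k + q_k| is at
    most [len p + len q]. *)
Let len_lipschitz p q : `|len p - len q| <= n%:R * enorm (p - q).
Proof.
have pq0 : 0 < len p + len q by exact: addr_gt0.
rewrite -(ler_pM2r pq0) -[X in _ * X](gtr0_norm pq0) -normrM -subr_sqr !len_sqr.
rewrite opprD addrACA subrr add0r /dot -sumrB (le_trans (ler_norm_sum _ _ _)) //.
have -> : n%:R * enorm (p - q) * (len p + len q) =
    \sum_(k < n) enorm (p - q) * (len p + len q).
  by rewrite sumr_const card_ord -mulrA mulr_natl.
apply: ler_sum => k _; rewrite -!expr2 subr_sqr normrM; apply: ler_pM => //.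
  by have := coord_le_enorm (p - q) k; rewrite !mxE.
by rewrite (le_trans (ler_normD _ _)) // lerD.
Qed.

(** The difference is (p_k - q_k) / len p plus (q_k / len q) times
    (len q - len p) / len p, where len p >= 1 and |q_k| <= len q. *)
Lemma normalized_lipschitz p q k :
  `|p 0 k / len p - q 0 k / len q| <= n.+1%:R * enorm (p - q).
Proof.
have -> : p 0 k / len p - q 0 k / len q =
    (p - q) 0 k / len p + q 0 k / len q * ((len q - len p) / len p).
  by rewrite !mxE; field; rewrite !gt_eqF.
have -> : n.+1%:R * enorm (p - q) = enorm (p - q) + n%:R * enorm (p - q).
  by rewrite -natr1; ring.
rewrite (le_trans (ler_normD _ _)) //.
have div_le (a b : R) : `|a| <= b -> `|a / len p| <= b.
  move=> ab; rewrite normrM normfV (gtr0_norm (len_gt0 p)) ler_pdivrMr //.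
  by rewrite (le_trans ab) // ler_peMr // (le_trans _ ab).
apply: lerD; first exact/div_le/coord_le_enorm.
rewrite normrM -[leRHS]mul1r; apply: ler_pM => //; last first.
  by apply: div_le; rewrite distrC.
by rewrite normrM normfV (gtr0_norm (len_gt0 q)) ler_pdivrMr // mul1r.
Qed.

End normalized.

Section bounds.
Variables (R : realType) (n : nat) (u : 'rV[R]_n -> R).
Hypothesis su : smooth u.
Implicit Types (x V : 'rV[R]_n) (i j k : 'I_n) (c : R).

Let grad_le_area x k : `|grad u x 0 k| <= area u x.
Proof. by rewrite (le_trans (coord_le_enorm _ k)) // ler_wsqrtr // lerDr. Qed.

Lemma gauss_lipschitz V j x :
  `|gauss u j x - V 0 j / Num.sqrt (1 + dot V V)| <=
  n.+1%:R * enorm (grad u x - V).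
Proof. by have := normalized_lipschitz (grad u x) V j; rewrite mxE. Qed.

(** Each entry of the Hessian is at most sqrt c W. In the formula for d_i F_j there
    is one factor 1 / W in front of the Hessian, and grad u / W is bounded. *)
Lemma partial_gauss_bounded c :
  (forall x, hsnorm (Hess u x) ^+ 2 <= c * (1 + enorm (grad u x) ^+ 2)) ->
  0 <= c -> forall i j x, `|partial i (gauss u j) x| <= Num.sqrt c * n.+1%:R.
Proof.
move=> Hc c0 i j x; have W0 := area_gt0 u x.
have Hle k l : `|Hess u x k l| <= Num.sqrt c * area u x.
  have H0 : 0 <= \sum_i \sum_j Hess u x i j ^+ 2.
    by apply: sumr_ge0 => a _; apply: sumr_ge0 => b _; exact: sqr_ge0.
  rewrite -sqrtr_sqr -[area u x](gtr0_norm W0) -sqrtr_sqr -sqrtrM //.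
  apply: ler_wsqrtr; rewrite area_sqr -enorm_sqr; apply: le_trans (Hc x).
    rewrite sqr_sqrtr // (bigD1 k) //= (bigD1 l) //= -addrA lerDl addr_ge0 //.
      by apply: sumr_ge0 => b _; exact: sqr_ge0.
    by apply: sumr_ge0 => a _; apply: sumr_ge0 => b _; exact: sqr_ge0.
have Sle : `|\sum_k Hess u x i k * grad u x 0 k| <= n%:R * (Num.sqrt c * area u x ^+ 2).
  rewrite (le_trans (ler_norm_sum _ _ _)) //.
  have -> : n%:R * (Num.sqrt c * area u x ^+ 2) =
      \sum_(k < n) Num.sqrt c * area u x * area u x.
    by rewrite sumr_const card_ord mulr_natl -mulrA expr2.
  by apply: ler_sum => k _; rewrite normrM; apply: ler_pM.
rewrite partial_gauss // normrM normfV (gtr0_norm W0) mulrC ler_pdivrMr //.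
have -> : Num.sqrt c * n.+1%:R * area u x =
    Num.sqrt c * area u x + Num.sqrt c * n%:R * area u x by rewrite -natr1; ring.
rewrite (le_trans (ler_normB _ _)) //.
apply: lerD => //; rewrite 2!normrM normrX normfV (gtr0_norm W0).
have -> : Num.sqrt c * n%:R * area u x =
    (area u x)^-1 ^+ 2 * (n%:R * (Num.sqrt c * area u x ^+ 2)) * area u x.
  by field; rewrite gt_eqF.
apply: ler_pM => //; first by rewrite mulr_ge0 // exprn_ge0 // invr_ge0 ltW.
by apply: ler_pM => //; rewrite exprn_ge0 // invr_ge0 ltW.
Qed.

End bounds.

(** * Flatness *)

Lemma partialN (R : realType) n (f : 'rV[R]_n -> R) i : smooth f ->
  partial i (fun x => - f x) = fun x => - partial i f x.
Proof.
by move=> sf; apply/funext => x; apply: deriveN; exact: smooth_derivable.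
Qed.

Lemma divergence_signed0 (R : realType) n (X : 'I_n -> 'rV[R]_n -> R)
    (G : 'rV[R]_n -> R) :
  (forall i, smooth (X i)) -> L1 G -> (forall x, 0 <= G x) ->
  (forall i x, `|X i x| <= G x) ->
  does_not_change_sign (fun x => \sum_i partial i (X i) x) ->
  forall x, \sum_i partial i (X i) x = 0.
Proof.
move=> sX iG G0 XG [div0|div0]; first exact: divergence_L1 iG G0 XG div0.
have E x : \sum_i partial i (fun y => - X i y) x = - \sum_i partial i (X i) x.
  by rewrite -sumrN; apply: eq_bigr => i _; rewrite partialN.
move=> x; apply: oppr_inj; rewrite oppr0 -E.
apply: (divergence_L1 _ iG G0) => [i|i y|y]; first exact: smoothN.
  by rewrite normrN.
by rewrite E oppr_ge0.
Qed.

Lemma L1_scale (R : realType) n (f : 'rV[R]_n -> R) c :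
  L1 f -> L1 (fun x => c * f x).
Proof. by move=> h; exact: (integrableZl measurableT _ h). Qed.

(** The integral of [c] over the cube of half-side r is c (2 r)^n, which is at least
    c r for r >= 1 and so is unbounded. *)
Lemma L1_cst0 (R : realType) n (c : R) : (0 < n)%N -> 0 <= c ->
  L1 (fun _ : 'rV[R]_n => c) -> c = 0.
Proof.
move=> n0 c0 ic; apply/eqP; rewrite eq_le c0 andbT leNgt; apply/negP => cpos.
pose I := \int[lebesgue_tuple R n]_t c.
have I0 : 0 <= I by exact: Rintegral_ge0.
pose r := I / c + 1; have r1 : 1 <= r by rewrite lerDr divr_ge0.
have r0 : 0 < r by exact: lt_le_trans r1.
have : \int[lebesgue_tuple R n]_t (box (cube 0 r) t * c) <= I.
  apply: le_Rintegral => //.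
    by apply: (@cube_integrable _ _ (fun=> c)) => //; exact: cst_continuous.
  by move=> t _; rewrite boxE; case: asboolP => _; rewrite ?mul1r ?mul0r.
have -> : \int[lebesgue_tuple R n]_t (box (cube 0 r) t * c) = (r *+ 2) ^+ n * c.
  by rewrite RintegralZr ?Rintegral_cube //; exact: integrable_cube.
apply/negP; rewrite -ltNge -ltr_pdivrMr //.
have rn : r <= (r *+ 2) ^+ n.
  have r2 : r <= r *+ 2 by rewrite mulr2n lerDl ltW.
  by rewrite (le_trans r2) // ler_eXnr // (le_trans r1).
by apply: lt_le_trans rn; rewrite ltrDl.
Qed.

(** The cancellation of the second-order terms in the divergence of [newton]. *)
Lemma sum2_cancel (W : zmodType) n (a b c d : 'I_n -> 'I_n -> W) :
  (forall i j, d i j = b j i) ->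
  \sum_i \sum_j ((a i j + b i j) - (c i j + d i j)) =
  \sum_i \sum_j a i j - \sum_i \sum_j c i j.
Proof.
move=> db.
have -> : \sum_i \sum_j a i j - \sum_i \sum_j c i j =
    (\sum_i \sum_j a i j + \sum_i \sum_j b i j) -
    (\sum_i \sum_j c i j + \sum_i \sum_j d i j).
  have -> : \sum_i \sum_j d i j = \sum_i \sum_j b i j.
    by rewrite exchange_big; do 2 apply: eq_bigr => ? _; exact: db.
  by rewrite opprD addrACA subrr addr0.
rewrite -!big_split -sumrB; apply: eq_bigr => i _.
by rewrite -!big_split -sumrB.
Qed.

Section flatness.
Variables (R : realType) (n : nat) (u : 'rV[R]_n -> R) (V : 'rV[R]_n) (c : R).
Hypothesis (su : smooth u) (iV : L1 (fun x => enorm (grad u x - V))).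
Implicit Types (x : 'rV[R]_n) (i j k : 'I_n).

Let e x := enorm (grad u x - V).

Let e0 x : 0 <= e x. Proof. exact: sqrtr_ge0. Qed.

(** Subtracting the value of the Gauss map on an affine graph of slope [V] makes it
    integrable and does not change its derivatives. *)
Definition gauss_shift i x : R := gauss u i x - V 0 i / Num.sqrt (1 + dot V V).

Let smooth_shift i : smooth (gauss_shift i).
Proof. by apply: smoothD; [exact: smooth_gauss|exact: smooth_cst]. Qed.

Let partial_shift i j : partial i (gauss_shift j) = partial i (gauss u j).
Proof.
rewrite partialD => [|x|x]; last 2 first.
- by apply: smooth_derivable; exact: smooth_gauss.
- exact: derivable_cst.
by rewrite partial_cst; apply/funext => x; rewrite addr0.
Qed.

Lemma tr_gauss_jacobian0 : does_not_change_sign (fun x => \tr (gauss_jacobian u x)) ->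
  forall x, \tr (gauss_jacobian u x) = 0.
Proof.
have E x : \tr (gauss_jacobian u x) = \sum_i partial i (gauss_shift i) x.
  by apply: eq_bigr => i _; rewrite mxE partial_shift.
move=> tr_sign x; rewrite E; move: x.
apply: (divergence_signed0 smooth_shift (L1_scale n.+1%:R iV)).
- by move=> x; rewrite mulr_ge0 // e0.
- by move=> i x; exact: gauss_lipschitz.
- by rewrite (_ : (fun _ => _) = fun x => \tr (gauss_jacobian u x)) //; apply/funext.
Qed.

(** The first Newton transformation tr DF - DF of the shape operator, applied to
    [gauss_shift]. *)
Let newton i x := \sum_j (partial j (gauss u j) x * gauss_shift i x -
                          partial j (gauss u i) x * gauss_shift j x).

Let smooth_newton_term i j : smooth (fun x =>
  partial j (gauss u j) x * gauss_shift i x -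
  partial j (gauss u i) x * gauss_shift j x).
Proof.
have sp k l : smooth (partial k (gauss u l)) by exact/smooth_partial/smooth_gauss.
by apply: smoothD; [|apply: smoothN]; apply: smoothM.
Qed.

Let div_newton x : \sum_i partial i (newton i) x =
  \tr (gauss_jacobian u x) ^+ 2 - \tr (gauss_jacobian u x *m gauss_jacobian u x).
Proof.
pose d i j := partial i (gauss u j) x.
pose dd i j k := partial i (partial j (gauss u k)) x.
have sp i j : smooth (partial i (gauss u j)) by apply: smooth_partial; exact: smooth_gauss.
have pM k (f g : 'rV[R]_n -> R) : smooth f -> smooth g ->
    partial k (fun y => f y * g y) x = f x * partial k g x + g x * partial k f x.
  by move=> sf sg; rewrite partialM // => y; exact: smooth_derivable.
have -> : \sum_i partial i (newton i) x = \sum_i \sum_j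
   ((d j j * d i i + gauss_shift i x * dd i j j) -
    (d j i * d i j + gauss_shift j x * dd i j i)).
  apply: eq_bigr => i _; rewrite partial_sum //; apply: eq_bigr => j _.
  rewrite partialD => [|y|y]; last 2 first.
  - by apply: smooth_derivable; exact: smoothM.
  - by apply: smooth_derivable; apply: smoothN; exact: smoothM.
  rewrite partialN; last exact: smoothM.
  rewrite (pM i _ _ (sp j j) (smooth_shift i)).
  by rewrite (pM i _ _ (sp j i) (smooth_shift j)) !partial_shift.
apply: etrans (sum2_cancel (fun i j => d j j * d i i)
  (b := fun i j => gauss_shift i x * dd i j j) (fun i j => d j i * d i j)
  (d := fun i j => gauss_shift j x * dd i j i) _) _.
  by move=> i j; rewrite /dd (partialC i j (smooth_gauss su i 2)).
congr (_ - _).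
  rewrite expr2 mulr_suml exchange_big; apply: eq_bigr => i _.
  by rewrite mulr_sumr; apply: eq_bigr => j _; rewrite !mxE.
apply: eq_bigr => i _; rewrite [RHS]mxE; apply: eq_bigr => j _.
by rewrite (mulrC (d j i)); congr (_ * _); rewrite [RHS]mxE.
Qed.

Hypotheses (c0 : 0 <= c) (Hc : forall x,
  hsnorm (Hess u x) ^+ 2 <= c * (1 + enorm (grad u x) ^+ 2)).

Lemma gauss_jacobian_minors0 :
  does_not_change_sign (fun x => \tr (gauss_jacobian u x) ^+ 2 -
    \tr (gauss_jacobian u x *m gauss_jacobian u x)) ->
  forall x, \tr (gauss_jacobian u x) ^+ 2 -
    \tr (gauss_jacobian u x *m gauss_jacobian u x) = 0.
Proof.
move=> sgn x; rewrite -div_newton; move: x.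
pose K := (Num.sqrt c * n.+1%:R) * n.+1%:R.
have K0 : 0 <= K by rewrite !mulr_ge0 // sqrtr_ge0.
apply: (divergence_signed0 _ (L1_scale (n%:R * (2 * K)) iV)) => [i|x|i x|].
- exact: smooth_sum.
- by rewrite !mulr_ge0 // e0.
- rewrite (le_trans (ler_norm_sum _ _ _)) //.
  have -> : n%:R * (2 * K) * e x = \sum_(j < n) (K * e x + K * e x).
    by rewrite sumr_const card_ord -mulr_natl; ring.
  apply: ler_sum => j _; rewrite (le_trans (ler_normB _ _)) //.
  have bound k l m : `|partial k (gauss u l) x * gauss_shift m x| <= K * e x.
    rewrite normrM -[K * _]mulrA; apply: ler_pM => //.
      exact: partial_gauss_bounded.
    exact: gauss_lipschitz.
  by apply: lerD; exact: bound.
- by rewrite (_ : (fun _ => _) = fun x => \tr (gauss_jacobian u x) ^+ 2 -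
    \tr (gauss_jacobian u x *m gauss_jacobian u x)) //; apply/funext.
Qed.

End flatness.

Lemma does_not_change_sign_div (R : realType) (T : Type) (f : T -> R) (a : R) :
  0 < a -> does_not_change_sign (fun x => f x / a) -> does_not_change_sign f.
Proof.
move=> a0 [f0|f0]; [left|right] => x; have := f0 x.
  by rewrite pmulr_lge0 // invr_gt0.
by rewrite pmulr_lle0 // invr_gt0.
Qed.

Lemma dot_graph (R : realType) n (x V : 'rV[R]_n) (a : R) :
  dot (row_mx x a%:M) (row_mx (- V) 1%:M) = a - dot x V.
Proof.
rewrite /dot big_split_ord addrC big_ord1 !row_mxEr !mxE eqxx !mulr1n mulr1 -sumrN.
by congr (_ + _); apply: eq_bigr => i _; rewrite !row_mxEl mxE mulrN.
Qed.

Theorem corollary2 (R : realType) (n : nat) (hn : (2 <= n)%N)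
    (u : 'rV[R]_n -> R) (hu : smooth u)
    (V : 'rV[R]_n) (hV : L1 (fun x => enorm (grad u x - V)))
    (c : R) (hc : 0 < c)
    (hHess : forall x, hsnorm (Hess u x) ^+ 2 <= c * (1 + enorm (grad u x) ^+ 2))
    (hH : does_not_change_sign (mean_curvature u))
    (hS : does_not_change_sign (scalar_curvature u)) :
  exists b : R, graph_of u = hyperplane (row_mx (- V) 1%:M) b.
Proof.
have n0 : (0 < n)%N by exact: ltnW.
have tr0 : forall x, \tr (gauss_jacobian u x) = 0.
  apply: (tr_gauss_jacobian0 hu hV); apply: (@does_not_change_sign_div _ _ _ n%:R).
    by rewrite ltr0n.
  by rewrite -(_ : mean_curvature u = fun x => \tr (gauss_jacobian u x) / n%:R) //;
    apply/funext => x; exact: mean_curvatureE.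
have minors0 := gauss_jacobian_minors0 hu hV (ltW hc) hHess.
have {}minors0 : forall x, \tr (gauss_jacobian u x) ^+ 2 -
    \tr (gauss_jacobian u x *m gauss_jacobian u x) = 0.
  apply: minors0; apply: (@does_not_change_sign_div _ _ _ (n * n.-1)%N%:R).
    by rewrite ltr0n muln_gt0 n0 -subn1 subn_gt0.
  rewrite -(_ : scalar_curvature u = fun x => (\tr (gauss_jacobian u x) ^+ 2 -
      \tr (gauss_jacobian u x *m gauss_jacobian u x)) / (n * n.-1)%N%:R) //.
  by apply/funext => x; exact: scalar_curvatureE.
have Hess0 x : Hess u x = 0.
  apply: (gauss_jacobian_sqr_tr0 hu); have /eqP := minors0 x.
  by rewrite tr0 expr0n sub0r oppr_eq0 => /eqP.
have gradE x y : grad u x = grad u y.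
  apply/rowP => j; rewrite !mxE; apply: (@grad0_cst _ _ (partial j u)) => [|i z].
    exact: (smooth_partial j hu 1).
  by have /matrixP/(_ i j) := Hess0 z; rewrite !mxE.
have gradV x : grad u x = V.
  have ic : L1 (fun _ : 'rV[R]_n => enorm (grad u x - V)).
    by move: hV; congr L1; apply/funext => y; rewrite (gradE y x).
  have gV0 := L1_cst0 n0 (sqrtr_ge0 _) ic; apply/subr0_eq/rowP => j.
  by apply/eqP; rewrite [X in _ == X]mxE -normr_le0 -gV0 coord_le_enorm.
have uE x : u x = dot x V + u 0.
  have du y : derivable u y x by exact/diff_derivable/smooth_differentiable.
  have [t _] := MVT_line 0 1 du; rewrite add0r scale1r mul1r => /(canRL (subrK _)) ->.
  by rewrite derive_grad ?gradV //; exact: hu.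
exists (u 0); apply/seteqP; split => [_ [x _ <-]|p].
  by rewrite /hyperplane /= dot_graph uE addrC addKr.
rewrite /hyperplane /= -[p]hsubmxK [rsubmx p]mx11_scalar dot_graph => pV.
exists (lsubmx p) => //; rewrite /graph_map; congr (row_mx _ _%:M).
by rewrite uE -pV addrC subrK.
Qed.
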